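(* Let $n\ge 2$ and let $\mathbb D^n=\{z\in\mathbb C^n: |z_j|<1,\ j=1,\dots,n\}$ be the unit polydisc. Then the canonical solution operator to $\overline\partial$ restricted to $(0,1)$-forms with coefficients in the Bergman space, $$S_1:A^2_{(0,1)}(\mathbb D^n)\to L^2(\mathbb D^n),$$ is not a Hilbert-Schmidt operator.
   Context: For a bounded domain $\Omega\subset\mathbb C^n$, $\lambda$ is Lebesgue measure, $L^2(\Omega)=L^2(\Omega,\lambda)$, and $A^2(\Omega)$ is the Bergman space of square-integrable holomorphic functions on $\Omega$. $A^2_{(0,1)}(\Omega)$ is the space of $(0,1)$-forms $g=\sum_{j=1}^n g_j\,d\overline z_j$ with all $g_j\in A^2(\Omega)$, a Hilbert space with norm $\|g\|^2=\sum_{j=1}^n\|g_j\|^2_{L^2(\Omega)}$. The canonical solution operator assigns to $g$ the unique $S_1(g)\in L^2(\Omega)$ with $\overline\partial S_1(g)=g$ and $S_1(g)\perp A^2(\Omega)$; equivalently, $S_1(g)=v-P(v)$ with $v(z)=\sum_{j=1}^n\overline z_j g_j(z)$ and $P:L^2(\Omega)\to A^2(\Omega)$ the orthogonal projection. *)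

(* Defs.v *)
From HB Require Import structures.
From mathcomp Require Import all_boot all_order all_algebra.
From mathcomp Require Import complex.
From mathcomp Require Import all_classical all_reals all_analysis.

Set Implicit Arguments.
Unset Strict Implicit.
Unset Printing Implicit Defensive.

Import Order.TTheory GRing.Theory Num.Theory.
Import numFieldNormedType.Exports.
Import ComplexField.Normc.

Local Open Scope classical_set_scope.
Local Open Scope ring_scope.
Local Open Scope complex_scope.

(* [R[i]^o] is the type of complex numbers seen as a normed space over itself,
   so that [differentiable] below is complex differentiability. *)
Notation Cn R n := 'rV[R[i]^o]_n.

Section LebesgueMeasure.
Context {R : realType}.

Definition coordC n (j : 'I_n) (z : Cn R n) : R * R :=
  (complex.Re (z 0 j), complex.Im (z 0 j)).

#[local] Lemma Cn_set0 n : g_sigma_preimage (@coordC n) set0.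
Proof. exact: sigma_algebra0. Qed.

#[local] Lemma Cn_setC n A :
  g_sigma_preimage (@coordC n) A -> g_sigma_preimage (@coordC n) (~` A).
Proof. exact: sigma_algebraC. Qed.

#[local] Lemma Cn_bigcup n (F : _^nat) :
  (forall i, g_sigma_preimage (@coordC n) (F i)) ->
  g_sigma_preimage (@coordC n) (\bigcup_i (F i)).
Proof. exact: sigma_algebra_bigcup. Qed.

(* The sigma-algebra on C^n is the product of the Borel sigma-algebras of the
   2n real coordinates, i.e. the Borel sigma-algebra of C^n. *)
HB.instance Definition _ n := @isMeasurable.Build default_measure_display
  (Cn R n) (g_sigma_preimage (@coordC n)) (@Cn_set0 n) (@Cn_setC n)
  (@Cn_bigcup n).

Definition consC n (p : Cn R n * R * R) : Cn R n.+1 :=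
  row_mx (const_mx (p.1.2 +i* p.2) : Cn R 1) p.1.1.

Lemma measurable_coordC n (j : 'I_n) : measurable_fun setT (@coordC n j).
Proof.
move=> _ Y mY; rewrite setTI; apply: sub_sigma_algebra => /=.
rewrite -bigcup_seq/=; exists j => /=; first by rewrite mem_index_enum.
by exists Y => //; rewrite setTI.
Qed.

Lemma measurable_CnP d (T : measurableType d) n (f : T -> Cn R n) :
  (forall j, measurable_fun setT (@coordC n j \o f)) -> measurable_fun setT f.
Proof.
move=> mf _ A mA.
have : g_sigma_preimage (fun j => @coordC n j \o f) `<=` measurable.
  apply: smallest_sub; first exact: sigma_algebra_measurable.
  rewrite -bigcup_seq; apply: bigcup_sub => i _.
  by move=> B [C mC <-]; exact: mf.
apply; rewrite g_sigma_preimage_comp.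
by exists A.
Qed.

Lemma measurable_consC n : measurable_fun setT (@consC n).
Proof.
apply: measurable_CnP => j.
have [k jk|k jk] := splitP (j : 'I_(1 + n)).
- rewrite (_ : _ \o _ = (fun p => (p.1.2, p.2))).
    apply: measurable_fun_pair => //; exact: measurableT_comp.
  apply/funext => p /=.
  suff jE : consC p 0 j = p.1.2 +i* p.2 by rewrite /coordC jE.
  rewrite (_ : j = lshift n k); last exact/val_inj.
  by rewrite [LHS]row_mxEl mxE.
- rewrite (_ : _ \o _ = coordC k \o (fst \o fst)).
    apply: measurableT_comp; first exact: measurable_coordC.
    exact: measurableT_comp.
  apply/funext => p /=.
  suff jE : consC p 0 j = p.1.1 0 k by rewrite /coordC jE.
  rewrite (_ : j = rshift 1 k); last exact/val_inj.
  by rewrite [LHS]row_mxEr.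
Qed.

Definition lebesgue_cons n (m : {measure set (Cn R n) -> \bar R}) :
    {measure set (Cn R n.+1) -> \bar R} :=
  measure_function_pushforward__canonical__measure_function_Measure
    ((m \x lebesgue_measure) \x lebesgue_measure)%E (@measurable_consC n).

(* Lebesgue measure on C^n = R^2n as an iterated product: the coordinates
   (x, y) of the new variable x + iy are put in front. *)
Fixpoint lebesgueC n : {measure set (Cn R n) -> \bar R} :=
  if n is m.+1 then lebesgue_cons (lebesgueC m) else \d_ (0 : Cn R 0).

End LebesgueMeasure.

Section BergmanSpace.
Context {R : realType} {n : nat}.
Implicit Types (D : set (Cn R n)) (f u phi : Cn R n -> R[i]^o).

Definition polydisc : set (Cn R n) := [set z : Cn R n | forall j, `|z 0 j| < 1].

Definition cintegral D f : R[i] :=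
  (\int[lebesgueC n]_(z in D) complex.Re (f z)) +i*
  (\int[lebesgueC n]_(z in D) complex.Im (f z)).

Definition inner_L2 D f (h : Cn R n -> R[i]^o) : R[i] :=
  cintegral D (fun z => f z * (h z)^*).

Definition sqnorm_L2 D f : \bar R :=
  (\int[lebesgueC n]_(z in D) (normc (f z) ^+ 2)%:E)%E.

Definition in_L2 D f : Prop :=
  [/\ measurable_fun D (fun z => complex.Re (f z)),
      measurable_fun D (fun z => complex.Im (f z)) &
      (sqnorm_L2 D f < +oo)%E].

Definition in_A2 D f : Prop :=
  in_L2 D f /\ (forall z, D z -> differentiable f z).

(* A (0,1)-form \sum_j g_j dzbar_j is given by its coefficients [g j]. *)
Definition form01 := 'I_n -> Cn R n -> R[i]^o.

Definition in_A2_01 D (g : form01) : Prop := forall j, in_A2 D (g j).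

Definition inner_form D (g h : form01) : R[i] := \sum_j inner_L2 D (g j) (h j).

Definition sqnorm_form D (g : form01) : \bar R :=
  (\sum_j sqnorm_L2 D (g j))%E.

(* Real directional derivative of a complex-valued function. *)
Definition rderivable f (v z : Cn R n) : Prop :=
  derivable (fun t : R => complex.Re (f (z + t%:C *: v))) 0 1 /\
  derivable (fun t : R => complex.Im (f (z + t%:C *: v))) 0 1.

Definition rderive f (v z : Cn R n) : R[i]^o :=
  derive1 (fun t : R => complex.Re (f (z + t%:C *: v))) 0 +i*
  derive1 (fun t : R => complex.Im (f (z + t%:C *: v))) 0.

(* C^k in the real sense on the whole of C^n. *)
Fixpoint Ck (k : nat) f : Prop :=
  continuous f /\
  if k is k'.+1 then
    forall v, (forall z, rderivable f v z) /\ Ck k' (rderive f v)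
  else True.

(* d/dzbar_j = (d/dx_j + i d/dy_j) / 2 *)
Definition dbar (j : 'I_n) phi (z : Cn R n) : R[i] :=
  (rderive phi (delta_mx 0 j) z + 'i * rderive phi ('i *: delta_mx 0 j) z) / 2.

Definition test_function D phi : Prop :=
  [/\ forall k, Ck k phi,
      compact (closure [set z | phi z != 0]) &
      closure [set z | phi z != 0] `<=` D].

(* dbar u = g in the sense of distributions on D. *)
Definition weak_dbar D u (g : form01) : Prop :=
  forall phi, test_function D phi -> forall j,
    cintegral D (fun z => u z * dbar j phi z) =
    - cintegral D (fun z => g j z * phi z).

Definition is_canonical_solution D (g : form01) u : Prop :=
  [/\ in_L2 D u, weak_dbar D u g & forall h, in_A2 D h -> inner_L2 D u h = 0].

(* The conditions determine [S g] up to a null set; [S g] is an arbitrary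
   representative of its class in L^2(D). *)
Definition is_canonical_solution_operator D (S : form01 -> Cn R n -> R[i]^o) :
    Prop :=
  forall g, in_A2_01 D g -> is_canonical_solution D g (S g).

Definition orthonormal_basis_A2_01 D (I : choiceType) (e : I -> form01) :
    Prop :=
  [/\ forall i, in_A2_01 D (e i),
      forall i k, inner_form D (e i) (e k) = (i == k)%:R &
      forall g, in_A2_01 D g -> forall eps : R, 0 < eps ->
        exists (s : seq I) (c : I -> R[i]),
          (sqnorm_form D (fun j z => g j z - \sum_(i <- s) c i * e i j z)%R
             < eps%:E)%E].

(* Meant for a bounded linear operator [S] from A^2_(0,1)(D) to L^2(D). The sum
   is then the same for all orthonormal bases. *)
Definition hilbert_schmidt D (S : form01 -> Cn R n -> R[i]^o) : Prop :=
  exists (I : choiceType) (e : I -> form01),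
    orthonormal_basis_A2_01 D e /\
    (\esum_(i in [set: I]) sqnorm_L2 D (S (e i)) < +oo)%E.

End BergmanSpace.

Arguments polydisc R n : clear implicits.

(* Main.v *)
Require Import Defs.
From mathcomp Require Import all_boot all_order all_algebra.
From mathcomp Require Import complex.
From mathcomp Require Import all_classical all_reals all_analysis.
From mathcomp Require Import measurable_realfun ring lra.

Set Implicit Arguments.
Unset Strict Implicit.
Unset Printing Implicit Defensive.

Import Order.TTheory GRing.Theory Num.Theory.
Import numFieldNormedType.Exports.
Import ComplexField.Normc.

Local Open Scope classical_set_scope.
Local Open Scope ring_scope.
Local Open Scope complex_scope.

(* Put r = 2^-m and t = 1 - r, let z_0 be the
   first coordinate and z_j another one (this is where n >= 2 enters), and let
   phi_r be a product of bump functions supported in the box B_r around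
   (t, 0, .., 0), of width of order r in z_0 and of order 1 in the other
   coordinates. Integration by parts gives
     int g_j phi_r = - int (S g) (dbar_j phi_r),
   and since dbar_j phi_r is bounded uniformly in r, the right-hand side squared
   is at most C r^2 int_(B_r) |S g|^2. The forms f_r = r (1 - t z_0)^-2 dzbar_j
   are bounded in L^2 and |int f_r phi_r| >= k r, so by Parseval every
   orthonormal basis e satisfies sum_i |int (e_i)_j phi_r|^2 >= k' r^2, that is
     sum_i int_(B_r) |S e_i|^2 >= delta
   with delta independent of m. The boxes B_r are pairwise disjoint, hence
   sum_i ||S e_i||^2 = +oo. *)

(** * Smooth functions with compact support *)

(** The powers of r decide the matter. The box B_r has volume of order r^2, and a derivative in z_j
    with j <> 0 acts on a factor whose width does not depend on r, so it costs no power of r. The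
    coefficient r (1 - t z_0)^-2 is, up to a constant, the normalised Bergman kernel of the disc at
    t; it has size 1/r on B_r, whence an integral of order r. The two sides of the comparison are
    then both of order r^2, and r cancels. With j = 0 the derivative would cost a factor 1/r, and
    the same argument would only bound the mass on B_r below by a multiple of r^2, which is summable
    over r = 2^-m. This is why the pole sits in one variable while the form points in the direction
    of another. A basis is known through finite approximations only, so the lower bounds are
    obtained on finite lists of indices. *)

Section Flat.
Context {R : realType}.

(** The polynomial in 1/x is carried along because the derivatives of e^(-1/x) produce such factors;
    with it the family is closed under differentiation. *)
Definition flat (p : {poly R}) (x : R) : R :=
  if 0 < x then p.[x^-1] * expR (- x^-1) else 0.

(** With y = 1/x one has dy/dx = -y^2, so p(y) e^(-y) has derivative y^2 (p(y) - p'(y)) e^(-y). *)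
Definition flat_deriv (p : {poly R}) : {poly R} := 'X^2 * (p - p^`()).

Lemma flat_gt0E p x : 0 < x -> flat p x = p.[x^-1] * expR (- x^-1).
Proof. by rewrite /flat => ->. Qed.

Lemma flat_le0 p x : x <= 0 -> flat p x = 0.
Proof. by rewrite /flat leNgt => /negbTE ->. Qed.

Lemma flat1_ge0 x : 0 <= flat 1 x.
Proof. by rewrite /flat; case: ifP => // _; rewrite hornerC mul1r expR_ge0. Qed.

Lemma flat1_gt0 x : 0 < x -> 0 < flat 1 x.
Proof. by move=> x0; rewrite flat_gt0E// hornerC mul1r expR_gt0. Qed.

Lemma flat1_le1 x : flat 1 x <= 1.
Proof.
rewrite /flat; case: ifP => // x0; rewrite hornerC mul1r expR_le1.
by rewrite oppr_le0 invr_ge0 ltW.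
Qed.

Lemma exprn_le_expR (y : R) i : 0 <= y -> y ^+ i <= i`!%:R * expR y.
Proof.
case: i => [|i] y0; first by rewrite expr0 mul1r -expR0 ler_expR.
rewrite mulrC -ler_pdivrMr ?ltr0n ?fact_gt0//.
by apply: le_trans (expR_ge1Dxn i y0); rewrite lerDr.
Qed.

Lemma horner_le_expR (p : {poly R}) :
  exists2 C, 0 <= C & forall y, 0 <= y -> `|p.[y]| <= C * expR y.
Proof.
exists (\sum_(i < size p) `|p`_i| * i`!%:R).
  by apply: sumr_ge0 => i _; rewrite mulr_ge0.
move=> y y0; rewrite horner_coef mulr_suml (le_trans (ler_norm_sum _ _ _))//.
apply: ler_sum => i _; rewrite normrM normrX (ger0_norm y0) -mulrA.
by rewrite ler_wpM2l// exprn_le_expR.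
Qed.

Lemma flat_bounded p : exists2 C, 0 <= C & forall x, `|flat p x| <= C.
Proof.
have [C C0 hC] := horner_le_expR p; exists C => // x.
rewrite /flat; case: ifP => x0; last by rewrite normr0.
rewrite normrM (ger0_norm (expR_ge0 _)) expRN ler_pdivrMr ?expR_gt0//.
by apply: hC; rewrite invr_ge0 ltW.
Qed.

(** Factoring out x^2 turns [p] into ['X^2 * p], whose [flat] is bounded. The quadratic decay gives
    [flat p] the derivative 0 at 0. *)
Lemma flat_le_sqr p : exists2 C, 0 <= C & forall x, `|flat p x| <= C * x ^+ 2.
Proof.
have [C C0 hC] := flat_bounded ('X^2 * p); exists C => // x.
have [x0|x0] := leP x 0; first by rewrite flat_le0// normr0 mulr_ge0 ?sqr_ge0.
have -> : flat p x = x ^+ 2 * flat ('X^2 * p) x.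
  by rewrite !flat_gt0E// hornerM hornerXn; field; rewrite gt_eqF.
by rewrite normrM ger0_norm ?sqr_ge0// mulrC ler_wpM2r ?sqr_ge0.
Qed.

Lemma is_derive_flat p x : is_derive x (1 : R) (flat p) (flat (flat_deriv p) x).
Proof.
have [x0|x0|->] := ltrgt0P x.
- rewrite flat_gt0E//.
  apply: (@near_eq_is_derive _ _ _
      ((horner p \o GRing.inv) * (expR \o (fun y => - y^-1)))).
    near=> y; rewrite flat_gt0E//.
    by near: y; exact: lt_nbhsr.
  have dV : is_derive x (1 : R) (fun y : R => y^-1) (- x ^- 2 *: 1).
    by apply: is_deriveV; rewrite gt_eqF.
  have dE : is_derive x (1 : R) (expR \o (fun y => - y^-1))
      (expR (- x^-1) * - (- x ^- 2 *: 1)).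
    by apply: is_derive1_comp.
  have dp : is_derive x (1 : R) (horner p \o GRing.inv)
      (p^`().[x^-1] * (- x ^- 2 *: 1)).
    by apply: is_derive1_comp.
  apply: is_derive_eq.
  rewrite /flat_deriv !hornerE /= /GRing.scale/=; field.
  by rewrite gt_eqF.
- rewrite flat_le0 ?ltW//.
  apply: (@near_eq_is_derive _ _ _ (cst 0)) => //.
  near=> y; rewrite flat_le0//.
  by apply: ltW; near: y; exact: lt_nbhsl.
- rewrite flat_le0//.
  have [C C0 hC] := flat_le_sqr p.
  have cvg0 : (fun h => h^-1 *: (flat p (h *: 1 + 0) - flat p 0)) @ 0^' --> (0 : R).
    apply/cvgr0Pnorm_le => e e0; near=> h.
    rewrite (flat_le0 p (lexx 0)) subr0 addr0 /GRing.scale/= mulr1 normrM normfV.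
    rewrite mulrC ler_pdivrMr ?normr_gt0; last first.
      by near: h; exact: nbhs_dnbhs_neq.
    apply: (le_trans (hC h)).
    rewrite -real_normK ?num_real// expr2 mulrA ler_wpM2r//.
    have -> : C * `|h| = `|h| * C by rewrite mulrC.
    (* Dividing by [C + 1] covers the case [C = 0]. *)
    have hh : `|h| <= e / (C + 1).
      near: h; apply: dnbhs0_le; rewrite divr_gt0// ltr_wpDl//.
    apply: (@le_trans _ _ (e / (C + 1) * (C + 1))).
      by rewrite ler_pM// lerDl.
    by rewrite divfK// gt_eqF// ltr_wpDl.
  by apply: DeriveDef; [apply/cvg_ex; exists 0|exact: cvg_lim].
Unshelve. all: by end_near. Qed.

Lemma continuous_flat p : continuous (flat p).
Proof.
move=> x; apply: differentiable_continuous; apply/derivable1_diffP.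
by have := is_derive_flat p x => -[].
Qed.

End Flat.

Section SmoothFunctions.
Context {R : realType} {n : nat}.
Implicit Types (f g : Cn R n -> R).

(* Sums and products of functions flat p (l z), with l a real-affine function of
   one coordinate: this class is closed under directional derivatives, which
   makes its members C^k for all k at once. *)
Inductive flat_alg : (Cn R n -> R) -> Prop :=
| flat_alg_cst c : flat_alg (fun=> c)
| flat_alg_add f g : flat_alg f -> flat_alg g -> flat_alg (fun z => f z + g z)
| flat_alg_mul f g : flat_alg f -> flat_alg g -> flat_alg (fun z => f z * g z)
| flat_alg_flat p (a a' b : R) (j : 'I_n) : flat_alg (fun z =>
    flat p (a * complex.Re (z 0 j) + a' * complex.Im (z 0 j) + b)).

Lemma flat_alg_prod (I : Type) (s : seq I) (F : I -> Cn R n -> R) :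
  (forall i, flat_alg (F i)) -> flat_alg (fun z => \prod_(i <- s) F i z).
Proof.
move=> hF; elim: s => [|i s ih].
  by under eq_fun do rewrite big_nil; exact: flat_alg_cst.
by under eq_fun do rewrite big_cons; exact: flat_alg_mul.
Qed.

Lemma continuous_Re : continuous (fun w : R[i]^o => complex.Re w : R).
Proof.
move=> w; apply/(@cvgrPdist_le _ _ _ (nbhs w) (nbhs_filter w)) => e e0.
exists e%:C => /= [|u /ltW]; first by rewrite ltcR.
case: w u => [a b] [c d] /=.
rewrite normc_def lecR/=; apply: le_trans.
by rewrite -sqrtr_sqr ler_sqrt ?addr_ge0 ?sqr_ge0// lerDl sqr_ge0.
Qed.

Lemma continuous_Im : continuous (fun w : R[i]^o => complex.Im w : R).
Proof.
move=> w; apply/(@cvgrPdist_le _ _ _ (nbhs w) (nbhs_filter w)) => e e0.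
exists e%:C => /= [|u /ltW]; first by rewrite ltcR.
case: w u => [a b] [c d] /=.
rewrite normc_def lecR/=; apply: le_trans.
by rewrite -sqrtr_sqr ler_sqrt ?addr_ge0 ?sqr_ge0// lerDr sqr_ge0.
Qed.

Lemma continuous_real_complex : continuous (fun x : R => x%:C : R[i]^o).
Proof.
move=> x; apply/cvgrPdist_le => e; rewrite ltcE/= => /andP[/eqP ei e0].
near=> y.
(* Positivity in the order of [R[i]] forces [e] to be real. *)
have -> : e = (complex.Re e)%:C by rewrite [LHS]complexE ei mulr0 addr0.
rewrite -rmorphB normc_def/= expr0n addr0 sqrtr_sqr lecR.
by near: y; apply: cvgr_dist_le; [exact: cvg_id|].
Unshelve. all: by end_near. Qed.

Lemma continuous_flat_alg f : flat_alg f -> continuous f.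
Proof.
elim=> {f} [c|f g _ cf _ cg|f g _ cf _ cg|p a a' b j] z.
- exact: cst_continuous.
- apply: (@continuousD _ _ _ f g z); [exact: cf|exact: cg].
- apply: (@continuousM _ _ f g z); [exact: cf|exact: cg].
- apply: (@continuous_comp _ _ _
    (fun z : Cn R n => a * complex.Re (z 0 j) + a' * complex.Im (z 0 j) + b)
    (flat p)); last exact: continuous_flat.
  have cj : {for z, continuous (fun z : Cn R n => z 0 j : R[i]^o)}.
    exact: coord_continuous.
  have cRe : {for z, continuous (fun z : Cn R n => complex.Re (z 0 j))}.
    by apply: (continuous_comp cj); exact: continuous_Re.
  have cIm : {for z, continuous (fun z : Cn R n => complex.Im (z 0 j))}.
    by apply: (continuous_comp cj); exact: continuous_Im.
  apply: continuousD; last exact: cst_continuous.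
  by apply: continuousD; apply: continuousM => //; exact: cst_continuous.
Qed.

Lemma flat_alg_derive f v : flat_alg f ->
  exists2 df, flat_alg df &
    forall z, is_derive (0 : R) (1 : R) (fun t : R => f (z + t%:C *: v)) (df z).
Proof.
elim=> {f} [c|f g sf [df sdf hf] sg [dg sdg hg]|
  f g sf [df sdf hf] sg [dg sdg hg]|p a a' b j].
- by exists (fun=> 0); [exact: flat_alg_cst|move=> z; exact: is_derive_cst].
- exists (fun z => df z + dg z); first exact: flat_alg_add.
  by move=> z; exact: is_deriveD.
- exists (fun z => f z * dg z + g z * df z).
    by apply: flat_alg_add; exact: flat_alg_mul.
  move=> z; have := is_deriveM (hf z) (hg z).
  by move=> h; apply: (is_derive_eq h); rewrite scale0r addr0.
- exists (fun z => flat (flat_deriv p)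
      (a * complex.Re (z 0 j) + a' * complex.Im (z 0 j) + b) *
      (a * complex.Re (v 0 j) + a' * complex.Im (v 0 j))).
    by apply: flat_alg_mul; [exact: flat_alg_flat|exact: flat_alg_cst].
  move=> z; set w := a * complex.Re (v 0 j) + _.
  set u := a * _ + _ + b.
  have -> : (fun t : R => flat p (a * complex.Re ((z + t%:C *: v) 0 j) +
      a' * complex.Im ((z + t%:C *: v) 0 j) + b)) =
      flat p \o (fun t => u + t * w).
    apply/funext => t /=; congr (flat p _); rewrite /u /w !mxE.
    case: (z 0 j) (v 0 j) => [z1 z2] [v1 v2] /=; ring.
  have dl : is_derive (0 : R) (1 : R) (fun t => u + t * w) w.
    have h := is_deriveD (is_derive_cst u (0 : R) (1 : R))
      (is_deriveM (is_derive_id (0 : R) (1 : R)) (is_derive_cst w (0 : R) (1 : R))).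
    by apply: (is_derive_eq h); rewrite scaler0 !add0r /GRing.scale/= mulr1.
  apply: is_derive1_comp.
  by have := is_derive_flat p (u + 0 * w); rewrite mul0r addr0.
Qed.

Lemma rderive_realE f df (v : Cn R n) :
  (forall z, is_derive (0 : R) (1 : R) (fun t : R => f (z + t%:C *: v)) (df z)) ->
  (forall z, rderivable (fun z => (f z)%:C) v z) /\
  rderive (fun z => (f z)%:C) v = fun z => (df z)%:C.
Proof.
move=> hf; split=> [z|].
  by split => /=; [have [] := hf z|exact: derivable_cst].
apply/funext => z; rewrite /rderive/= !derive1E.
have [_ ->] := hf z.
by rewrite derive_cst.
Qed.

Lemma Ck_flat_alg k f : flat_alg f -> Ck k (fun z => (f z)%:C : R[i]^o).
Proof.
elim: k f => [|k ih] f sf.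
  split=> // z; apply: continuous_comp; first exact: continuous_flat_alg.
  exact: continuous_real_complex.
split.
  move=> z; apply: continuous_comp; first exact: continuous_flat_alg.
  exact: continuous_real_complex.
move=> v; have [df sdf hf] := flat_alg_derive v sf.
by have [? ->] := rderive_realE hf; split=> //; exact: ih.
Qed.

Lemma measurable_ReC (D : set (Cn R n)) (j : 'I_n) :
  measurable_fun D (fun z : Cn R n => complex.Re (z 0 j)).
Proof.
apply: (@measurable_funS _ _ _ _ setT) => //.
exact: (measurableT_comp measurable_fst (measurable_coordC j)).
Qed.

Lemma measurable_ImC (D : set (Cn R n)) (j : 'I_n) :
  measurable_fun D (fun z : Cn R n => complex.Im (z 0 j)).
Proof.
apply: (@measurable_funS _ _ _ _ setT) => //.
exact: (measurableT_comp measurable_snd (measurable_coordC j)).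
Qed.

Lemma measurable_flat_alg (D : set (Cn R n)) f : flat_alg f -> measurable_fun D f.
Proof.
elim=> {f} [c|f g _ mf _ mg|f g _ mf _ mg|p a a' b j].
- exact: measurable_cst.
- exact: measurable_funD.
- exact: measurable_funM.
- apply: (measurableT_comp (f := flat p)).
    by apply: continuous_measurable_fun; exact: continuous_flat.
  apply: measurable_funD; last exact: measurable_cst.
  by apply: measurable_funD; apply: measurable_funM;
    try exact: measurable_cst; [exact: measurable_ReC|exact: measurable_ImC].
Qed.

End SmoothFunctions.

(** * One-variable bump functions *)

Section Hat.
Context {R : realType}.

Definition hat (x : R) : R := flat 1 (1 + x) * flat 1 (1 - x).

Definition dhat (x : R) : R :=
  flat (flat_deriv 1) (1 + x) * flat 1 (1 - x) -
  flat 1 (1 + x) * flat (flat_deriv 1) (1 - x).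

Lemma hat_ge0 x : 0 <= hat x.
Proof. by rewrite mulr_ge0 ?flat1_ge0. Qed.

Lemma hat_le1 x : hat x <= 1.
Proof. by rewrite mulr_ile1 ?flat1_ge0 ?flat1_le1. Qed.

Lemma hat_eq0 x : 1 <= `|x| -> hat x = 0.
Proof.
rewrite ler_normr /hat => /orP[h|h].
  by rewrite (@flat_le0 _ _ (1 - x)) ?mulr0//; lra.
by rewrite (@flat_le0 _ _ (1 + x)) ?mul0r//; lra.
Qed.

Lemma dhat_eq0 x : 1 <= `|x| -> dhat x = 0.
Proof.
rewrite ler_normr /dhat => /orP[h|h].
  by rewrite !(@flat_le0 _ _ (1 - x)) ?mulr0 ?subr0//; lra.
by rewrite !(@flat_le0 _ _ (1 + x)) ?mul0r ?subr0//; lra.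
Qed.

Lemma le_flat1 (x y : R) : 0 < x -> x <= y -> flat 1 x <= flat 1 y.
Proof.
move=> x0 xy; have y0 := lt_le_trans x0 xy.
by rewrite !flat_gt0E// !hornerC !mul1r ler_expR lerN2 lef_pV2.
Qed.

Lemma hat_ge x : `|x| <= 1 / 2 -> flat 1 (1 / 2) ^+ 2 <= hat x.
Proof.
rewrite ler_norml => /andP[h1 h2].
by rewrite expr2 ler_pM ?flat1_ge0 ?le_flat1//; lra.
Qed.

Lemma dhat_bounded : exists2 C : R, 0 <= C & forall x, `|dhat x| <= C.
Proof.
have [C C0 hC] := @flat_bounded R (flat_deriv 1).
exists (C * 1 + 1 * C); first by rewrite mulr1 mul1r addr_ge0.
have h1 x : `|flat 1 x| <= 1 :> R by rewrite ger0_norm ?flat1_ge0 ?flat1_le1.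
move=> x; rewrite (le_trans (ler_normB _ _))// !normrM.
by rewrite lerD// ler_pM// ?hC ?h1.
Qed.

(** [M] is meant for the factors of a product bump that stay constant along the line, and [k] for
    the inverse width of the moving coordinate. *)
Lemma is_derive_hat_line (u k M : R) : is_derive (0 : R) (1 : R)
  (fun t => hat (u + t * k) * M) (dhat u * k * M).
Proof.
have line (a b : R) : is_derive (0 : R) (1 : R) (fun t => a + t * b) b.
  have h := is_deriveD (is_derive_cst a (0 : R) (1 : R))
    (is_deriveM (is_derive_id (0 : R) (1 : R)) (is_derive_cst b (0 : R) (1 : R))).
  by apply: (is_derive_eq h); rewrite scaler0 !add0r /GRing.scale/= mulr1.
have atom (a b : R) : is_derive (0 : R) (1 : R)
    (flat 1 \o (fun t => a + t * b)) (flat (flat_deriv 1) a * b).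
  apply: is_derive1_comp.
  by have := is_derive_flat 1 (a + 0 * b); rewrite mul0r addr0.
have h := is_deriveM (is_deriveM (atom (1 + u) k) (atom (1 - u) (- k)))
  (is_derive_cst M (0 : R) (1 : R)).
have -> : (fun t => hat (u + t * k) * M) =
    (flat 1 \o (fun t => 1 + u + t * k)) *
    (flat 1 \o (fun t => 1 - u + t * - k)) * cst M.
  apply/funext => t; rewrite /hat; congr (flat _ _ * flat _ _ * M); ring.
apply: (is_derive_eq h); rewrite /= !mul0r !addr0 /GRing.scale/= /dhat.
by ring.
Qed.

End Hat.

(** * Product bumps on boxes of C^n *)

Section Box.
Context {R : realType} {n : nat}.
Implicit Types (c s : 'I_n -> R).

(** Rectangles in the real and imaginary parts, centred on the real axis: bumps and volumes then
    factor over the 2n real coordinates. *)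
Definition box c s : set (Cn R n) :=
  [set z : Cn R n | forall j, `|complex.Re (z 0 j) - c j| < s j /\
                              `|complex.Im (z 0 j)| < s j].

Definition closed_box c s : set (Cn R n) :=
  [set z : Cn R n | forall j, `|complex.Re (z 0 j) - c j| <= s j /\
                              `|complex.Im (z 0 j)| <= s j].

Definition hatC (a b : R) (w : R[i]) : R :=
  hat ((complex.Re w - a) / b) * hat (complex.Im w / b).

Definition box_hat c s (z : Cn R n) : R := \prod_j hatC (c j) (s j) (z 0 j).

Lemma hatC_ge0 a b w : 0 <= hatC a b w.
Proof. by rewrite mulr_ge0 ?hat_ge0. Qed.

Lemma hatC_le1 a b w : hatC a b w <= 1.
Proof. by rewrite mulr_ile1 ?hat_ge0 ?hat_le1. Qed.

Lemma normr_div_ge1 (x b : R) : 0 < b -> b <= `|x| -> 1 <= `|x / b|.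
Proof.
by move=> b0 bx; rewrite normrM normfV (gtr0_norm b0) ler_pdivlMr// mul1r.
Qed.

Lemma hatC_eq0 a b w : 0 < b ->
  b <= `|complex.Re w - a| \/ b <= `|complex.Im w| -> hatC a b w = 0.
Proof.
move=> b0 [h|h]; rewrite /hatC.
  by rewrite (@hat_eq0 _ ((_ - a) / b)) ?mul0r ?normr_div_ge1.
by rewrite (@hat_eq0 _ (complex.Im w / b)) ?mulr0 ?normr_div_ge1.
Qed.

Lemma not_boxP c s z : ~ box c s z -> exists j,
  s j <= `|complex.Re (z 0 j) - c j| \/ s j <= `|complex.Im (z 0 j)|.
Proof.
move/existsNP => [j /not_andP h]; exists j.
by case: h => /negP; rewrite -leNgt; [left|right].
Qed.

Lemma box_hat_ge0 c s z : 0 <= box_hat c s z.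
Proof. by apply: prodr_ge0 => j _; exact: hatC_ge0. Qed.

Lemma box_hat_le1 c s z : box_hat c s z <= 1.
Proof. by apply: prodr_ile1 => j _; rewrite hatC_ge0 hatC_le1. Qed.

Lemma box_hat_eq0 c s z : (forall j, 0 < s j) -> ~ box c s z ->
  box_hat c s z = 0.
Proof.
by move=> s0 /not_boxP[j h]; rewrite /box_hat (bigD1 j)//= hatC_eq0 ?mul0r.
Qed.

(** On the half-size box each of the 2n arguments of [hat] has modulus at most 1/2, where [hat_ge]
    applies. *)
Lemma box_hat_ge c s z : (forall j, 0 < s j) ->
  box c (fun j => s j / 2) z ->
  (flat 1 (1 / 2 : R) ^+ 2 * flat 1 (1 / 2) ^+ 2) ^+ n <= box_hat c s z.
Proof.
move=> s0 hz; rewrite -[X in _ ^+ X](card_ord n) -prodr_const /box_hat.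
have half (x b : R) : 0 < b -> `|x| < b / 2 -> `|x / b| <= 1 / 2.
  move=> b0 h; rewrite normrM normfV (gtr0_norm b0) ler_pdivrMr//.
  by rewrite mul1r mulrC ltW.
apply: ler_prod => j _; rewrite mulr_ge0 ?exprn_ge0 ?flat1_ge0//=.
have [h1 h2] := hz j.
by apply: ler_pM; rewrite ?exprn_ge0 ?flat1_ge0// hat_ge// half.
Qed.

Lemma flat_alg_hatC a b (j : 'I_n) :
  flat_alg (fun z : Cn R n => hatC a b (z 0 j)).
Proof.
have h1 := flat_alg_flat 1 b^-1 0 (1 - a / b) j.
have h2 := flat_alg_flat 1 (- b^-1) 0 (1 + a / b) j.
have h3 := flat_alg_flat 1 0 b^-1 1 j.
have h4 := flat_alg_flat 1 0 (- b^-1) 1 j.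
have := flat_alg_mul (flat_alg_mul h1 h2) (flat_alg_mul h3 h4).
congr flat_alg; apply/funext => z; rewrite /hatC /hat.
by congr (flat _ _ * flat _ _ * (flat _ _ * flat _ _)); ring.
Qed.

Lemma flat_alg_box_hat c s : flat_alg (box_hat c s).
Proof. by apply: flat_alg_prod => j; exact: flat_alg_hatC. Qed.

Lemma compact_rectangle (a b : R) : compact [set w : R[i]^o |
  `|complex.Re w - a| <= b /\ `|complex.Im w| <= b].
Proof.
have -> : [set w : R[i]^o | `|complex.Re w - a| <= b /\ `|complex.Im w| <= b] =
    (fun p : R * R => p.1%:C + 'i * p.2%:C : R[i]^o) @`
    (`[a - b, a + b]%classic `*` `[- b, b]%classic).
  apply/seteqP; split => [w /= [h1 h2]|_ /= [[x y] [/= hx hy] <-]].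
    exists (complex.Re w, complex.Im w) => /=; last by rewrite -complexE.
    by move: h1 h2; rewrite !in_itv/= ler_distl ler_norml.
  move: hx hy; rewrite !in_itv/= => hx hy.
  rewrite !mul0r !mul1r !subr0 !addr0 !add0r ler_distl ler_norml.
  by split.
apply: continuous_compact; last first.
  by apply: compact_setX; exact: segment_compact.
apply: continuous_subspaceT => p.
have c1 : {for p, continuous (fun p : R * R => p.1%:C : R[i]^o)}.
  apply: (@continuous_comp _ _ _ (@fst R R) (fun x : R => x%:C : R[i]^o)).
    exact: cvg_fst.
  exact: continuous_real_complex.
have c2 : {for p, continuous (fun p : R * R => p.2%:C : R[i]^o)}.
  apply: (@continuous_comp _ _ _ (@snd R R) (fun x : R => x%:C : R[i]^o)).
    exact: cvg_snd.
  exact: continuous_real_complex.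
apply: (@continuousD _ _ _ (fun p : R * R => p.1%:C : R[i]^o)
  (fun p : R * R => 'i * p.2%:C : R[i]^o) p c1).
apply: (@continuousM _ _ (fun p : R * R => 'i : R[i]^o)
  (fun p : R * R => p.2%:C : R[i]^o) p _ c2).
exact: cst_continuous.
Qed.

Lemma compact_closed_box c s : compact (closed_box c s).
Proof.
by apply: (rV_compact (fun j => @compact_rectangle (c j) (s j))).
Qed.

Lemma closure_box_hat c s : (forall j, 0 < s j) ->
  closure [set z | (box_hat c s z)%:C != 0 :> R[i]] `<=` closed_box c s.
Proof.
move=> s0.
have cK : closed (closed_box c s).
  apply: compact_closed; last exact: compact_closed_box.
  exact: norm_hausdorff.
rewrite (closure_id (closed_box c s)).1//; apply: closure_subset => z /= /eqP.
apply: contra_notP => hz; rewrite box_hat_eq0// => hb; apply: hz => j.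
by have [/ltW ? /ltW ?] := hb j.
Qed.

Lemma test_function_box_hat (D : set (Cn R n)) c s : (forall j, 0 < s j) ->
  closed_box c s `<=` D ->
  test_function D (fun z => (box_hat c s z)%:C : R[i]^o).
Proof.
move=> s0 KD; split=> [k||].
- exact: Ck_flat_alg (flat_alg_box_hat c s).
- apply: (subclosed_compact _ (compact_closed_box (c := c) (s := s))).
    exact: closed_closure.
  exact: closure_box_hat.
- exact: subset_trans (closure_box_hat s0) KD.
Qed.

End Box.

(** * The dbar-derivatives of product bumps *)

Section DbarHat.
Context {R : realType} {n : nat}.
Implicit Types (f : Cn R n -> R) (c s : 'I_n -> R).

Lemma dbar_realE f dx dy (j : 'I_n) :
  (forall z, is_derive (0 : R) (1 : R)
     (fun t : R => f (z + t%:C *: delta_mx 0 j)) (dx z)) ->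
  (forall z, is_derive (0 : R) (1 : R)
     (fun t : R => f (z + t%:C *: ('i *: delta_mx 0 j))) (dy z)) ->
  dbar j (fun z => (f z)%:C) = fun z => (dx z / 2) +i* (dy z / 2).
Proof.
move=> hx hy; apply/funext => z; rewrite /dbar.
rewrite (rderive_realE hx).2 (rderive_realE hy).2.
have -> : 2 = (2 : R)%:C :> R[i] by rewrite rmorph_nat.
rewrite -fmorphV/=; apply/eqP; rewrite eq_complex/=.
by rewrite !(mul0r, mul1r, mulr0, subr0, add0r, addr0) !eqxx.
Qed.

Lemma measurable_dbar_real (D : set (Cn R n)) f (j : 'I_n) : flat_alg f ->
  measurable_fun D (fun z => complex.Re (dbar j (fun z => (f z)%:C) z)) /\
  measurable_fun D (fun z => complex.Im (dbar j (fun z => (f z)%:C) z)).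
Proof.
move=> sf.
have [dx sdx hx] := flat_alg_derive (delta_mx 0 j : Cn R n) sf.
have [dy sdy hy] := flat_alg_derive ('i *: delta_mx 0 j : Cn R n) sf.
rewrite (dbar_realE hx hy); split=> /=; apply: measurable_funM;
  by [exact: measurable_flat_alg|exact: measurable_cst].
Qed.

Let rest c s (j : 'I_n) (z : Cn R n) : R :=
  \prod_(i | i != j) hatC (c i) (s i) (z 0 i).

(** [w = 1] and [w = 'i] give the two real directions of the j-th coordinate; only one factor of the
    product moves. *)
Lemma box_hat_line c s (j : 'I_n) (z : Cn R n) (w : R[i]) (t : R) :
  box_hat c s (z + t%:C *: (w *: delta_mx 0 j)) =
  hatC (c j) (s j) (z 0 j + t%:C * w) * rest c s j z.
Proof.
rewrite /box_hat /rest (bigD1 j)//= !mxE !eqxx mulr1; congr (_ * _).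
apply: eq_bigr => i ij; rewrite !mxE eqxx (negbTE ij).
by rewrite !mulr0 addr0.
Qed.

Lemma is_derive_box_hat_re c s (j : 'I_n) (z : Cn R n) :
  is_derive (0 : R) (1 : R)
    (fun t : R => box_hat c s (z + t%:C *: delta_mx 0 j))
    (dhat ((complex.Re (z 0 j) - c j) / s j) * (s j)^-1 *
     (hat (complex.Im (z 0 j) / s j) * rest c s j z)).
Proof.
have := is_derive_hat_line ((complex.Re (z 0 j) - c j) / s j) (s j)^-1
  (hat (complex.Im (z 0 j) / s j) * rest c s j z).
congr is_derive; apply/funext => t.
rewrite -[delta_mx 0 j]scale1r box_hat_line mulr1 /hatC mulrA.
case: (z 0 j) => a b /=; rewrite addr0.
by congr (hat _ * _ * _); ring.
Qed.

Lemma is_derive_box_hat_im c s (j : 'I_n) (z : Cn R n) :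
  is_derive (0 : R) (1 : R)
    (fun t : R => box_hat c s (z + t%:C *: ('i *: delta_mx 0 j)))
    (dhat (complex.Im (z 0 j) / s j) * (s j)^-1 *
     (hat ((complex.Re (z 0 j) - c j) / s j) * rest c s j z)).
Proof.
have := is_derive_hat_line (complex.Im (z 0 j) / s j) (s j)^-1
  (hat ((complex.Re (z 0 j) - c j) / s j) * rest c s j z).
congr is_derive; apply/funext => t.
rewrite box_hat_line /hatC mulrA.
case: (z 0 j) => a b /=; rewrite !(mulr0, mul0r, mulr1, subr0, addr0).
rewrite [in RHS](mulrC (hat ((a - c j) / s j))).
by congr (hat _ * _ * _); ring.
Qed.

(** Outside the box the factor of some coordinate i vanishes. If i <> j, this factor survives the
    differentiation; if i = j, [hat] and [dhat] vanish at the same argument, which kills both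
    partial derivatives. *)
Lemma dbar_box_hat_eq0 c s (j : 'I_n) (z : Cn R n) :
  (forall i, 0 < s i) -> ~ box c s z ->
  dbar j (fun z => (box_hat c s z)%:C) z = 0.
Proof.
move=> s0 /not_boxP[i hi].
rewrite (dbar_realE (is_derive_box_hat_re c s j) (is_derive_box_hat_im c s j)).
apply/eqP; rewrite eq_complex/=.
have [ij|ij] := eqVneq i j; last first.
  have -> : rest c s j z = 0 by rewrite /rest (bigD1 i)//= hatC_eq0 ?mul0r.
  by rewrite !(mulr0, mul0r) eqxx.
rewrite -ij; case: hi => h.
  rewrite (@dhat_eq0 _ ((_ - _) / _)) ?normr_div_ge1//.
  rewrite (@hat_eq0 _ ((_ - _) / _)) ?normr_div_ge1//.
  by rewrite !(mulr0, mul0r) eqxx.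
rewrite (@dhat_eq0 _ (complex.Im _ / _)) ?normr_div_ge1//.
rewrite (@hat_eq0 _ (complex.Im _ / _)) ?normr_div_ge1//.
by rewrite !(mulr0, mul0r) eqxx.
Qed.

Lemma normc_le_add (x y : R) : normc (x +i* y) <= `|x| + `|y|.
Proof.
rewrite -[leRHS]ger0_norm ?addr_ge0// -sqrtr_sqr /= ler_sqrt ?sqr_ge0//.
by rewrite sqrrD !real_normK ?num_real// lerD2r lerDl mulrn_wge0// mulr_ge0.
Qed.

(** Only the width of the differentiated coordinate enters, since every other factor lies in [0, 1].
    A box may therefore shrink in the remaining coordinates at no cost, with the same [C] for all
    boxes. *)
Lemma normc_dbar_box_hat : exists2 C : R, 0 <= C & forall c s (j : 'I_n) z,
  (forall i, 0 < s i) ->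
  normc (dbar j (fun z => (box_hat c s z)%:C) z) <= C / s j.
Proof.
have [C C0 hC] := @dhat_bounded R; exists C => // c s j z s0.
rewrite (dbar_realE (is_derive_box_hat_re c s j) (is_derive_box_hat_im c s j)).
have rest01 : 0 <= rest c s j z <= 1.
  apply/andP; split; first by apply: prodr_ge0 => i _; exact: hatC_ge0.
  by apply: prodr_ile1 => i _; rewrite hatC_ge0 hatC_le1.
have bd u v : `|dhat u * (s j)^-1 * (hat v * rest c s j z) / 2| <= C / s j / 2.
  rewrite normrM (ger0_norm (_ : 0 <= 2^-1))// ler_wpM2r//.
  rewrite -[leRHS]mulr1 normrM ler_pM//.
    have sV0 : 0 <= (s j)^-1 by rewrite invr_ge0 ltW.
    by rewrite normrM (ger0_norm sV0) (ler_wpM2r sV0).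
  case/andP: rest01 => r0 r1.
  rewrite ger0_norm; first by rewrite mulr_ile1 ?hat_ge0 ?hat_le1.
  by rewrite mulr_ge0 ?hat_ge0.
apply: (le_trans (normc_le_add _ _)).
by apply: (le_trans (lerD (bd _ _) (bd _ _))); rewrite -splitr.
Qed.

End DbarHat.

(** * Square-integrable functions and forms *)

Section L2.
Context {R : realType} {n : nat} (D : set (Cn R n)) (mD : measurable D).
Implicit Types (f g h : Cn R n -> R[i]^o) (u : Cn R n -> R).
Local Notation mu := (lebesgueC n).

Lemma normc_sqrE (z : R[i]) :
  normc z ^+ 2 = complex.Re z ^+ 2 + complex.Im z ^+ 2.
Proof. by case: z => a b /=; rewrite sqr_sqrtr// addr_ge0 ?sqr_ge0. Qed.

Lemma normc_ge0 (z : R[i]) : 0 <= normc z.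
Proof. by case: z => a b /=; exact: sqrtr_ge0. Qed.

Lemma normcD_sqr_le (z w : R[i]) :
  normc (z + w) ^+ 2 <= 2 * normc z ^+ 2 + 2 * normc w ^+ 2.
Proof.
rewrite !normc_sqrE; case: z w => [a b] [c d] /=.
have := sqr_ge0 (a - c); have := sqr_ge0 (b - d); rewrite !sqrrB !sqrrD; lra.
Qed.

Definition cintegrable f := mu.-integrable D (fun z => (complex.Re (f z))%:E) /\
  mu.-integrable D (fun z => (complex.Im (f z))%:E).

Lemma integrable_lincomb u v (a b : R) :
  mu.-integrable D (fun z => (u z)%:E) -> mu.-integrable D (fun z => (v z)%:E) ->
  mu.-integrable D (fun z => (a * u z + b * v z)%:E).
Proof.
move=> iu iv.
have := integrableD mD (integrableZl mD a iu) (integrableZl mD b iv).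
by apply: eq_integrable.
Qed.

Lemma Rintegral_lincomb u v (a b : R) :
  mu.-integrable D (fun z => (u z)%:E) -> mu.-integrable D (fun z => (v z)%:E) ->
  \int[mu]_(z in D) (a * u z + b * v z) =
  a * \int[mu]_(z in D) u z + b * \int[mu]_(z in D) v z.
Proof.
move=> iu iv; rewrite RintegralD//; first by rewrite !RintegralZl.
  by apply: eq_integrable (integrableZl mD a iu).
by apply: eq_integrable (integrableZl mD b iv).
Qed.

Lemma Re_mulc (z w : R[i]) : complex.Re (z * w) =
  complex.Re z * complex.Re w + - complex.Im z * complex.Im w.
Proof. by case: z w => [a b] [c d] /=; rewrite mulNr. Qed.

Lemma Im_mulc (z w : R[i]) : complex.Im (z * w) =
  complex.Re z * complex.Im w + complex.Im z * complex.Re w.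
Proof. by case: z w => [a b] [c d]. Qed.

Lemma Re_addc (z w : R[i]) : complex.Re (z + w) = complex.Re z + complex.Re w.
Proof. by case: z w => [a b] [c d]. Qed.

Lemma Im_addc (z w : R[i]) : complex.Im (z + w) = complex.Im z + complex.Im w.
Proof. by case: z w => [a b] [c d]. Qed.

Lemma cintegralZD f g (a : R[i]) : cintegrable f -> cintegrable g ->
  cintegral D (fun z => a * f z + g z) = a * cintegral D f + cintegral D g.
Proof.
move=> [f1 f2] [g1 g2]; apply/eqP; rewrite eq_complex; apply/andP; split.
- rewrite Re_addc Re_mulc /=; apply/eqP.
  rewrite -(Rintegral_lincomb (complex.Re a) (- complex.Im a) f1 f2).
  rewrite -[X in _ = X + _]mul1r -[X in _ = _ + X]mul1r.
  rewrite -Rintegral_lincomb//; last exact: integrable_lincomb.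
  by apply: eq_Rintegral => z _; rewrite Re_addc Re_mulc !mul1r.
- rewrite Im_addc Im_mulc /=; apply/eqP.
  rewrite -(Rintegral_lincomb (complex.Re a) (complex.Im a) f2 f1).
  rewrite -[X in _ = X + _]mul1r -[X in _ = _ + X]mul1r.
  rewrite -Rintegral_lincomb//; last exact: integrable_lincomb.
  by apply: eq_Rintegral => z _; rewrite Im_addc Im_mulc !mul1r.
Qed.

Lemma measurable_normc_sqr f :
  measurable_fun D (fun z => complex.Re (f z)) ->
  measurable_fun D (fun z => complex.Im (f z)) ->
  measurable_fun D (fun z => normc (f z) ^+ 2).
Proof.
move=> mRe mIm; under eq_fun do rewrite normc_sqrE.
by apply: measurable_funD; exact: measurable_funX.
Qed.

Lemma integrable_normc_sqr f : in_L2 D f ->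
  mu.-integrable D (fun z => (normc (f z) ^+ 2)%:E).
Proof.
move=> [mRe mIm foo]; apply/integrableP; split.
  by apply/measurable_EFinP; exact: measurable_normc_sqr.
rewrite (_ : (fun z => _) = (fun z => (normc (f z) ^+ 2)%:E))//.
by apply/funext => z; rewrite gee0_abs// lee_fin sqr_ge0.
Qed.

Lemma integrable_le_normc_sqr f g u : in_L2 D f -> in_L2 D g ->
  measurable_fun D u ->
  (forall z, `|u z| <= normc (f z) ^+ 2 + normc (g z) ^+ 2) ->
  mu.-integrable D (fun z => (u z)%:E).
Proof.
move=> f2 g2 mu_ le.
apply: le_integrable (integrable_lincomb 1 1 (integrable_normc_sqr f2)
  (integrable_normc_sqr g2)) => //.
  exact/measurable_EFinP.
move=> z _; rewrite !mul1r /= lee_fin.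
by apply: (le_trans (le z)); rewrite ler_norm.
Qed.

Lemma cintegrable_inner f g : in_L2 D f -> in_L2 D g ->
  cintegrable (fun z => f z * (g z)^*).
Proof.
move=> f2 g2; have [f1 f1' _] := f2; have [g1 g1' _] := g2; split.
- apply: (integrable_le_normc_sqr f2 g2).
    rewrite (_ : (fun z => _) = (fun z => complex.Re (f z) * complex.Re (g z) +
      complex.Im (f z) * complex.Im (g z))).
      by apply: measurable_funD; exact: measurable_funM.
    by apply/funext => z; rewrite Re_mulc; case: (g z) => a b /=; rewrite mulrNN.
  move=> z; rewrite Re_mulc !normc_sqrE ler_norml.
  case: (f z) (g z) => [a b] [c d] /=.
  have := (sqr_ge0 (a - c), sqr_ge0 (a + c), sqr_ge0 (b - d), sqr_ge0 (b + d)).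
  have := (sqr_ge0 a, sqr_ge0 b, sqr_ge0 c, sqr_ge0 d).
  by rewrite !sqrrB !sqrrD => -[[[? ?] ?] ?] [[[? ?] ?] ?]; apply/andP; split; lra.
- apply: (integrable_le_normc_sqr f2 g2).
    rewrite (_ : (fun z => _) = (fun z => complex.Im (f z) * complex.Re (g z) -
      complex.Re (f z) * complex.Im (g z))).
      by apply: measurable_funB; exact: measurable_funM.
    by apply/funext => z; rewrite Im_mulc; case: (g z) => a b /=; rewrite mulrN addrC.
  move=> z; rewrite Im_mulc !normc_sqrE ler_norml.
  case: (f z) (g z) => [a b] [c d] /=.
  have := (sqr_ge0 (a - d), sqr_ge0 (a + d), sqr_ge0 (b - c), sqr_ge0 (b + c)).
  have := (sqr_ge0 a, sqr_ge0 b, sqr_ge0 c, sqr_ge0 d).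
  by rewrite !sqrrB !sqrrD => -[[[? ?] ?] ?] [[[? ?] ?] ?]; apply/andP; split; lra.
Qed.

Lemma in_L20 : in_L2 D (fun=> 0).
Proof.
split; [exact: measurable_cst|exact: measurable_cst|].
rewrite /sqnorm_L2 (eq_integral (cst 0%E)) ?integral0// => z _ /=.
by rewrite expr0n/= addr0 sqrtr0 expr0n.
Qed.

Lemma in_L2ZD f g (a : R[i]) : in_L2 D f -> in_L2 D g ->
  in_L2 D (fun z => a * f z + g z).
Proof.
move=> f2 g2; have [f1 f1' _] := f2; have [g1 g1' _] := g2.
have mRe : measurable_fun D (fun z => complex.Re (a * f z + g z)).
  under eq_fun do rewrite Re_addc Re_mulc.
  apply: measurable_funD => //.
  by apply: measurable_funD; apply: measurable_funM => //; exact: measurable_cst.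
have mIm : measurable_fun D (fun z => complex.Im (a * f z + g z)).
  under eq_fun do rewrite Im_addc Im_mulc.
  apply: measurable_funD => //.
  by apply: measurable_funD; apply: measurable_funM => //; exact: measurable_cst.
split => //.
have := integrable_lincomb (2 * normc a ^+ 2) 2
  (integrable_normc_sqr f2) (integrable_normc_sqr g2).
move=> /integrableP[mb]; apply: le_lt_trans.
apply: ge0_le_integral => //.
- by move=> z _; rewrite lee_fin sqr_ge0.
- by apply/measurable_EFinP; exact: measurable_normc_sqr.
- exact: measurableT_comp.
- move=> z _; rewrite /= lee_fin (le_trans _ (ler_norm _))//.
  by rewrite (le_trans (normcD_sqr_le _ _))// normcM exprMn mulrA.
Qed.

Lemma inner_L2ZD f g h (a : R[i]) : in_L2 D f -> in_L2 D g -> in_L2 D h ->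
  inner_L2 D (fun z => a * f z + g z) h = a * inner_L2 D f h + inner_L2 D g h.
Proof.
move=> f2 g2 h2; rewrite /inner_L2 -cintegralZD; try exact: cintegrable_inner.
by congr cintegral; apply/funext => z; rewrite mulrDl mulrA.
Qed.

Lemma inner_L2_conj f g : in_L2 D f -> in_L2 D g ->
  inner_L2 D g f = (inner_L2 D f g)^*.
Proof.
move=> f2 g2; have [_ ii] := cintegrable_inner f2 g2.
apply/eqP; rewrite eq_complex /=; apply/andP; split; apply/eqP.
  apply: eq_Rintegral => z _; rewrite !Re_mulc.
  by case: (f z) (g z) => [a b] [c d] /=; ring.
rewrite -mulN1r -RintegralZl//.
apply: eq_Rintegral => z _; rewrite !Im_mulc.
by case: (f z) (g z) => [a b] [c d] /=; ring.
Qed.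

Lemma sqnorm_L2E f : in_L2 D f ->
  sqnorm_L2 D f = (complex.Re (inner_L2 D f f))%:E.
Proof.
move=> f2; rewrite /= /Rintegral fineK; last first.
  exact: integrable_fin_num (cintegrable_inner f2 f2).1.
apply: eq_integral => z _; rewrite Re_mulc normc_sqrE.
by case: (f z) => a b /=; rewrite mulrNN.
Qed.

Lemma inner_L2_ge0 f : 0 <= complex.Re (inner_L2 D f f).
Proof.
apply: Rintegral_ge0 => z _; rewrite Re_mulc.
by case: (f z) => a b /=; rewrite mulrNN -!expr2 addr_ge0 ?sqr_ge0.
Qed.

(** Expanding the squared norm of f - t <f, h> h for real t gives [key]; for [H > 0] the quadratic
    is minimal at t = 1/H. *)
Lemma cauchy_schwarz_L2 f h : in_L2 D f -> in_L2 D h ->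
  normc (inner_L2 D f h) ^+ 2 <=
  complex.Re (inner_L2 D f f) * complex.Re (inner_L2 D h h).
Proof.
move=> f2 h2; set a := inner_L2 D f h.
set F := complex.Re (inner_L2 D f f); set H := complex.Re (inner_L2 D h h).
have F0 : 0 <= F := inner_L2_ge0 f.
have H0 : 0 <= H := inner_L2_ge0 h.
have key (t : R) : 0 <= F - 2 * t * normc a ^+ 2 + t ^+ 2 * normc a ^+ 2 * H.
  pose k := - (t%:C * a); pose p : Cn R n -> R[i]^o := fun z => k * h z + f z.
  have p2 : in_L2 D p by exact: in_L2ZD.
  have := inner_L2_ge0 p.
  rewrite {1}/p inner_L2ZD// (inner_L2_conj p2 h2) (inner_L2_conj p2 f2) {1 2}/p.
  rewrite !inner_L2ZD// (inner_L2_conj f2 h2) -/a.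
  congr (_ <= _).
  have hh : complex.Im (inner_L2 D h h) = 0.
    have := inner_L2_conj h2 h2; case: (inner_L2 D h h) => x y /= [].
    by move=> /eqP; rewrite -addr_eq0 -mulr2n mulrn_eq0/= => /eqP.
  rewrite /F /H /k normc_sqrE; move: hh.
  case: (a) => a1 a2; case: (inner_L2 D h h) => x y /= ->.
  case: (inner_L2 D f f) => x' y' /=.
  by ring.
have [H0'|] := eqVneq H 0.
  rewrite H0' mulr0 leNgt; apply/negP => a0.
  (* For [H = 0] the expression is affine in t, and this t makes it F - (F + 1) = -1. *)
  have := key ((F + 1) / (2 * normc a ^+ 2)).
  rewrite H0' mulr0 addr0.
  have -> : 2 * ((F + 1) / (2 * normc a ^+ 2)) * normc a ^+ 2 = F + 1.
    by field; move: a0; rewrite lt0r => /andP[]; rewrite expf_eq0.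
  lra.
move=> Hn0; have Hp : 0 < H by rewrite lt0r Hn0.
have := key H^-1.
have -> : F - 2 * H^-1 * normc a ^+ 2 + H^-1 ^+ 2 * normc a ^+ 2 * H =
  (F * H - normc a ^+ 2) / H by field.
by rewrite pmulr_lge0 ?invr_gt0// subr_ge0.
Qed.

Lemma in_L2_sum (I : Type) (s : seq I) (c : I -> R[i])
    (e : I -> Cn R n -> R[i]^o) : (forall i, in_L2 D (e i)) ->
  in_L2 D (fun z => \sum_(i <- s) c i * e i z).
Proof.
move=> e2; elim: s => [|i s ih].
  by under eq_fun do rewrite big_nil; exact: in_L20.
by under eq_fun do rewrite big_cons; exact: in_L2ZD.
Qed.

Lemma inner_L20 h : inner_L2 D (fun=> 0) h = 0.
Proof.
rewrite /inner_L2 /cintegral; apply/eqP; rewrite eq_complex/=.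
by rewrite !(eq_Rintegral _ (g := cst 0)) ?Rintegral_cst// => [|z _|z _];
  rewrite ?mul0r ?eqxx.
Qed.

Lemma inner_L2_sum (I : Type) (s : seq I) (c : I -> R[i])
    (e : I -> Cn R n -> R[i]^o) h : (forall i, in_L2 D (e i)) -> in_L2 D h ->
  inner_L2 D (fun z => \sum_(i <- s) c i * e i z) h =
  \sum_(i <- s) c i * inner_L2 D (e i) h.
Proof.
move=> e2 h2; elim: s => [|i s ih].
  by under eq_fun do rewrite big_nil; rewrite big_nil inner_L20.
under eq_fun do rewrite big_cons.
by rewrite inner_L2ZD ?ih ?big_cons//; exact: in_L2_sum.
Qed.

End L2.

(** * Orthonormal families of forms and the mass of a functional on them *)

Section FormBessel.
Context {R : realType} {n : nat} (D : set (Cn R n)) (mD : measurable D).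
Implicit Types (f g h : Cn R n -> R[i]^o) (F G : @form01 R n).
Local Notation mu := (lebesgueC n).

Lemma Re_inner_L2E f :
  complex.Re (inner_L2 D f f) = \int[mu]_(z in D) (normc (f z) ^+ 2).
Proof.
apply: eq_Rintegral => z _; rewrite Re_mulc normc_sqrE.
by case: (f z) => a b /=; rewrite mulrNN.
Qed.

Lemma sqnorm_formE G : (forall j, in_L2 D (G j)) ->
  sqnorm_form D G = (complex.Re (inner_form D G G))%:E.
Proof.
move=> G2; rewrite /sqnorm_form /inner_form raddf_sum -sumEFin.
by apply: eq_bigr => j _; rewrite sqnorm_L2E.
Qed.

Lemma sqnorm_L2_le_form G (j : 'I_n) : (forall j, in_L2 D (G j)) ->
  complex.Re (inner_L2 D (G j) (G j)) <= complex.Re (inner_form D G G).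
Proof.
move=> G2; rewrite /inner_form raddf_sum (bigD1 j)//= lerDl.
by apply: sumr_ge0 => i _; exact: inner_L2_ge0.
Qed.

Lemma Re_inner_L2D_le f g : in_L2 D f -> in_L2 D g ->
  complex.Re (inner_L2 D (fun z => f z + g z) (fun z => f z + g z)) <=
  2 * complex.Re (inner_L2 D f f) + 2 * complex.Re (inner_L2 D g g).
Proof.
move=> f2 g2; rewrite !Re_inner_L2E.
have fg2 : in_L2 D (fun z => f z + g z).
  have := in_L2ZD mD 1 f2 g2.
  by congr in_L2; apply/funext => z; rewrite mul1r.
have i1 := integrable_normc_sqr f2; have i2 := integrable_normc_sqr g2.
rewrite -Rintegral_lincomb//; apply: le_Rintegral => //.
- exact: integrable_normc_sqr.
- exact: integrable_lincomb.
- by move=> z _; exact: normcD_sqr_le.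
Qed.

Lemma sum_cauchy_schwarz (I : Type) (s : seq I) (a b : I -> R) :
  (forall i, 0 <= a i) -> (forall i, 0 <= b i) ->
  (\sum_(i <- s) a i * b i) ^+ 2 <=
  (\sum_(i <- s) a i ^+ 2) * (\sum_(i <- s) b i ^+ 2).
Proof.
move=> a0 b0; elim: s => [|i s ih]; first by rewrite !big_nil expr0n mul0r.
rewrite !big_cons; move: ih.
set S := \sum_(j <- s) a j * b j; set A := \sum_(j <- s) a j ^+ 2.
set B := \sum_(j <- s) b j ^+ 2 => SAB.
have S0 : 0 <= S by apply: sumr_ge0 => j _; exact: mulr_ge0.
have A0 : 0 <= A by apply: sumr_ge0 => j _; exact: sqr_ge0.
have B0 : 0 <= B by apply: sumr_ge0 => j _; exact: sqr_ge0.
(* The cross term, compared after squaring: S^2 <= A B, and then 4 A B a^2 b^2 <= (A b^2 + B a^2)^2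
   because the difference is a square. *)
have : S * (2 * (a i * b i)) <= A * b i ^+ 2 + B * a i ^+ 2.
  rewrite -(@ler_pXn2r _ 2)// ?nnegrE ?addr_ge0 ?mulr_ge0 ?sqr_ge0//.
  apply: (@le_trans _ _ (A * B * (2 * (a i * b i)) ^+ 2)).
    by rewrite exprMn; apply: ler_wpM2r => //; exact: sqr_ge0.
  rewrite -subr_ge0.
  have -> : (A * b i ^+ 2 + B * a i ^+ 2) ^+ 2 - A * B * (2 * (a i * b i)) ^+ 2 =
    (A * b i ^+ 2 - B * a i ^+ 2) ^+ 2 by ring.
  exact: sqr_ge0.
move=> h.
have -> : (a i * b i + S) ^+ 2 =
    a i ^+ 2 * b i ^+ 2 + S * (2 * (a i * b i)) + S ^+ 2 by ring.
have -> : (a i ^+ 2 + A) * (b i ^+ 2 + B) =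
    a i ^+ 2 * b i ^+ 2 + (A * b i ^+ 2 + B * a i ^+ 2) + A * B by ring.
by rewrite lerD// lerD2l.
Qed.

Lemma normc_sum_cauchy_schwarz (I : Type) (s : seq I) (c x : I -> R[i]) :
  normc (\sum_(i <- s) c i * x i) ^+ 2 <=
  (\sum_(i <- s) normc (c i) ^+ 2) * (\sum_(i <- s) normc (x i) ^+ 2).
Proof.
apply: le_trans (sum_cauchy_schwarz _ _ _); last 2 first.
- by move=> i; exact: normc_ge0.
- by move=> i; exact: normc_ge0.
rewrite ler_pXn2r ?nnegrE ?normc_ge0//; last first.
  by apply: sumr_ge0 => i _; rewrite mulr_ge0 ?normc_ge0.
elim: s => [|i s ih]; first by rewrite !big_nil normc0.
rewrite !big_cons (le_trans (le_normcD _ _))// normcM.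
by rewrite lerD2l.
Qed.

Section Orthonormal.
Variables (I : choiceType) (e : I -> @form01 R n).
Hypothesis e2 : forall i j, in_L2 D (e i j).
Hypothesis eon : forall i k, inner_form D (e i) (e k) = (i == k)%:R.

Let comb (s : seq I) (c : I -> R[i]) : @form01 R n :=
  fun j z => \sum_(i <- s) c i * e i j z.

Lemma inner_form_comb s c G : (forall j, in_L2 D (G j)) ->
  inner_form D (comb s c) G = \sum_(i <- s) c i * inner_form D (e i) G.
Proof.
move=> G2; rewrite /inner_form.
under eq_bigr do rewrite inner_L2_sum//.
by rewrite exchange_big/=; apply: eq_bigr => i _; rewrite mulr_sumr.
Qed.

Lemma inner_form_conj F G : (forall j, in_L2 D (F j)) ->
  (forall j, in_L2 D (G j)) -> inner_form D G F = (inner_form D F G)^*.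
Proof.
move=> F2 G2; rewrite /inner_form rmorph_sum.
by apply: eq_bigr => j _; rewrite inner_L2_conj.
Qed.

Lemma Re_inner_form_comb s c : uniq s ->
  complex.Re (inner_form D (comb s c) (comb s c)) =
  \sum_(i <- s) normc (c i) ^+ 2.
Proof.
move=> us.
have c2 j : in_L2 D (comb s c j) by exact: in_L2_sum.
rewrite inner_form_comb// raddf_sum big_seq [RHS]big_seq.
apply: eq_bigr => i si /=.
rewrite (inner_form_conj c2)//.
have -> : inner_form D (comb s c) (e i) = c i.
  rewrite inner_form_comb// (bigD1_seq i)//= eon eqxx mulr1.
  rewrite big1 ?addr0// => k ki.
  by rewrite eon (negbTE ki) mulr0.
by rewrite Re_mulc normc_sqrE; case: (c i) => a b /=; rewrite mulrNN.
Qed.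

(** The density condition on a basis allows repeated indices in its list, while the norm of a
    combination is read off its coefficients only for distinct ones; multiplicities move into the
    coefficients. *)
Lemma comb_undup s c : exists c', comb s c = comb (undup s) c'.
Proof.
exists (fun i => c i *+ count_mem i s); apply/funext => j; apply/funext => z.
rewrite /comb -(big_undup_iterop_count _ s xpredT (fun i => c i * e i j z)).
by apply: eq_bigr => i _; rewrite mulrnAl.
Qed.

End Orthonormal.

(* Stands in for Parseval's identity, without the Riesz representative in A^2 of
   the functional <-, phi> on the j-th component. *)
Lemma basis_functional_mass (I : choiceType) (e : I -> @form01 R n) F phi
    (j : 'I_n) (l M : R) :
  orthonormal_basis_A2_01 D e -> in_A2_01 D F -> in_L2 D phi ->
  0 < l -> l <= normc (inner_L2 D (F j) phi) ->
  complex.Re (inner_form D F F) <= M ->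
  exists2 s : seq I, uniq s &
    l ^+ 2 / (8 * (M + 1)) <= \sum_(i <- s) normc (inner_L2 D (e i j) phi) ^+ 2.
Proof.
move=> [eA eon eapp] FA phi2 l0 lF FM.
have e2 i k : in_L2 D (e i k) by exact: (eA i k).1.
have F2 k : in_L2 D (F k) by exact: (FA k).1.
pose N := complex.Re (inner_L2 D phi phi).
have N0 : 0 <= N by exact: inner_L2_ge0.
have M0 : 0 <= M.
  by apply: le_trans FM; rewrite /inner_form raddf_sum sumr_ge0// => k _;
    exact: inner_L2_ge0.
(* The bound 1 controls the norm of the approximating combination [G]; the other one makes the
   functional of the error [E] at most l/2 in modulus. *)
pose eps := Num.min 1 (l ^+ 2 / (4 * (N + 1))).
have N1 : 0 < N + 1 by rewrite ltr_wpDl.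
have eps0 : 0 < eps.
  by rewrite lt_min ltr01/= divr_gt0 ?exprn_gt0// mulr_gt0.
have [s0 [c0 h0]] := eapp F FA eps eps0.
have [c hc] := comb_undup e s0 c0; set s := undup s0 in hc.
have us : uniq s by exact: undup_uniq.
pose G : @form01 R n := fun k z => \sum_(i <- s) c i * e i k z.
pose E : @form01 R n := fun k z => F k z - G k z.
have G2 k : in_L2 D (G k) by exact: in_L2_sum.
have E2 k : in_L2 D (E k).
  have := in_L2ZD mD (-1) (G2 k) (F2 k).
  by congr in_L2; apply/funext => z; rewrite /E mulN1r addrC.
have EE : complex.Re (inner_form D E E) < eps.
  have : (sqnorm_form D E < eps%:E)%E.
    move: h0; congr (_ < _)%E; congr sqnorm_form.
    apply/funext => k; apply/funext => z; rewrite /E; congr (_ - _).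
    by have := congr1 (fun f : @form01 R n => f k z) hc => /= ->.
  by rewrite sqnorm_formE// lte_fin.
have GG : complex.Re (inner_form D G G) <= 2 * M + 2.
  have : complex.Re (inner_form D G G) <=
      2 * complex.Re (inner_form D F F) + 2 * complex.Re (inner_form D E E).
    rewrite /inner_form !raddf_sum/= !mulr_sumr -big_split/=.
    apply: ler_sum => k _.
    change (complex.Re (inner_L2 D (G k) (G k)) <=
      2 * complex.Re (inner_L2 D (F k) (F k)) +
      2 * complex.Re (inner_L2 D (E k) (E k))).
    have En2 : in_L2 D (fun z => - E k z).
      have := in_L2ZD mD (-1) (E2 k) (@in_L20 R n D).
      by congr in_L2; apply/funext => z; rewrite mulN1r addr0.
    have := Re_inner_L2D_le (F2 k) En2.
    have -> : (fun z => F k z + - E k z) = G k.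
      by apply/funext => z; rewrite /E opprB addrC subrK.
    rewrite !Re_inner_L2E => h. apply: (le_trans h).
    rewrite lerD2l ler_wpM2l// le_eqVlt; apply/orP; left; apply/eqP.
    by apply: eq_Rintegral => z _; rewrite normcN.
  have : eps <= 1 by rewrite ge_min lexx.
  lra.
(* From l^2 <= 2 |<G_j, phi>|^2 + 2 |<E_j, phi>|^2, where the last term is at most l^2 / 2. *)
have lG : l ^+ 2 / 4 <= normc (inner_L2 D (G j) phi) ^+ 2.
  have FGE : inner_L2 D (F j) phi = inner_L2 D (G j) phi + inner_L2 D (E j) phi.
    rewrite -[inner_L2 D (G j) phi]mul1r -inner_L2ZD//; congr inner_L2.
    by apply/funext => z; rewrite /E mul1r addrC subrK.
  have := normcD_sqr_le (inner_L2 D (G j) phi) (inner_L2 D (E j) phi).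
  rewrite -FGE.
  have : l ^+ 2 <= normc (inner_L2 D (F j) phi) ^+ 2.
    by rewrite ler_pXn2r ?nnegrE ?normc_ge0// ltW.
  have : normc (inner_L2 D (E j) phi) ^+ 2 <= l ^+ 2 / 4.
    apply: (le_trans (cauchy_schwarz_L2 mD (E2 j) phi2)).
    apply: (@le_trans _ _ (eps * (N + 1))).
      apply: ler_pM; rewrite ?inner_L2_ge0 ?lerDl//.
      exact: le_trans (sqnorm_L2_le_form j E2) (ltW EE).
    have : eps <= l ^+ 2 / (4 * (N + 1)) by rewrite ge_min lexx orbT.
    move=> /(ler_wpM2r (ltW N1)) /le_trans; apply.
    rewrite le_eqVlt; apply/orP; left; apply/eqP; field.
    by rewrite gt_eqF.
  lra.
exists s => //.
have := normc_sum_cauchy_schwarz s c (fun i => inner_L2 D (e i j) phi).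
rewrite -inner_L2_sum// -(Re_inner_form_comb e2 eon c us) -/G.
set X := \sum_(i <- s) _ => h.
have X0 : 0 <= X by apply: sumr_ge0 => i _; exact: sqr_ge0.
(* This reads l^2 / 4 <= (2 M + 2) X, the source of the factor 8 (M + 1). *)
have hX := le_trans lG (le_trans h (ler_wpM2r X0 GG)).
have M1 : 0 < 8 * (M + 1) by lra.
by rewrite ler_pdivrMr//; nra.
Qed.

End FormBessel.

(** * Volume of boxes *)

Section BoxMeasure.
Context {R : realType}.

Lemma measurable_forall n (P : 'I_n -> set (Cn R n)) :
  (forall j, measurable (P j)) -> measurable [set z : Cn R n | forall j, P j z].
Proof.
move=> mP; have -> : [set z : Cn R n | forall j, P j z] = \bigcap_j P j.
  by apply/seteqP; split => z /= h j => [_|]; exact: h.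
by apply: fin_bigcap_measurable => // j _; exact: mP.
Qed.

Lemma measurable_box n (c s : 'I_n -> R) : measurable (box c s).
Proof.
apply: (@measurable_forall n (fun j => [set z : Cn R n |
  `|complex.Re (z 0 j) - c j| < s j /\ `|complex.Im (z 0 j)| < s j])) => j.
have mRe : measurable_fun setT (fun z : Cn R n => complex.Re (z 0 j) - c j).
  by apply: measurable_funB; [exact: measurable_ReC|exact: measurable_cst].
have mIm : measurable_fun setT (fun z : Cn R n => complex.Im (z 0 j)).
  exact: measurable_ImC.
have h1 := mRe measurableT _ (measurable_ball (0 : R) (s j)).
have h2 := mIm measurableT _ (measurable_ball (0 : R) (s j)).
have := measurableI _ _ h1 h2.
congr (measurable _); rewrite !setTI; apply/seteqP.
by split=> z /=; rewrite /ball/= !sub0r !normrN.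
Qed.

Lemma polydisc_measurable n : measurable (polydisc R n).
Proof.
apply: (@measurable_forall n (fun j => [set z : Cn R n | `|z 0 j| < 1])) => j.
have mf : measurable_fun setT (fun z : Cn R n =>
    complex.Re (z 0 j) ^+ 2 + complex.Im (z 0 j) ^+ 2).
  apply: measurable_funD; apply: measurable_funX;
    [exact: measurable_ReC|exact: measurable_ImC].
have := mf measurableT _ (measurable_itv `]-oo, (1 : R)[).
congr (measurable _); rewrite setTI.
have E (z : Cn R n) : (`|z 0 j| < 1) =
    (complex.Re (z 0 j) ^+ 2 + complex.Im (z 0 j) ^+ 2 < 1).
  by rewrite normc_def ltcR -[X in _ < X = _]sqrtr1 ltr_sqrt.
by apply/seteqP; split=> z /=; rewrite in_itv/= E.
Qed.

(** [consC] pulls a box back to a product of a box of lower dimension and two intervals, so the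
    product measure factors and induction applies. *)
Lemma lebesgueC_box n (c s : 'I_n -> R) : (forall j, 0 < s j) ->
  lebesgueC n (box c s) = (\prod_j (2 * s j) ^+ 2)%:E.
Proof.
elim: n c s => [|n ih] c s s0.
  rewrite big_ord0 /= diracE mem_set// => j.
  by case: j.
have -> : lebesgueC n.+1 (box c s) =
    ((lebesgueC n \x lebesgue_measure) \x lebesgue_measure)%E
      (@consC R n @^-1` (box c s)) by [].
have -> : @consC R n @^-1` (box c s) =
    (box (fun j => c (lift ord0 j)) (fun j => s (lift ord0 j)) `*`
     ball (c ord0) (s ord0)) `*` ball 0 (s ord0).
  have c0 (p : Cn R n * R * R) : consC p 0 ord0 = p.1.2 +i* p.2.
    rewrite (_ : ord0 = lshift n (ord0 : 'I_1)); last exact/val_inj.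
    by rewrite [LHS]row_mxEl mxE.
  have cS (p : Cn R n * R * R) k : consC p 0 (lift ord0 k) = p.1.1 0 k.
    rewrite (_ : lift ord0 k = rshift 1 k); last exact/val_inj.
    by rewrite [LHS]row_mxEr.
  apply/seteqP; split => p /=.
    move=> h; have [h1 h2] := h ord0.
    rewrite c0/= in h1 h2.
    split; last by rewrite /ball/= sub0r normrN.
    split; last by rewrite /ball/= distrC.
    by move=> j; have := h (lift ord0 j); rewrite cS.
  move=> [[h1]]; rewrite /ball/= sub0r normrN distrC => h2 h3 j.
  have [k ->|->] := unliftP ord0 j; last by rewrite c0.
  by rewrite cS; exact: h1.
have mB := measurable_box (fun j => c (lift ord0 j)) (fun j => s (lift ord0 j)).
have mX := measurable_ball (c ord0) (s ord0).
have mY := measurable_ball (0 : R) (s ord0).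
have E1 := @product_measure1E _ _ _ _ R (lebesgueC n) (@lebesgue_measure R) _ _ mB mX.
have E2 := @product_measure1E _ _ _ _ R (lebesgueC n \x @lebesgue_measure R)%E
  (@lebesgue_measure R) _ _ (measurableX mB mX) mY.
have L1 := lebesgue_measure_ball (c ord0) (ltW (s0 ord0)).
have L2 := lebesgue_measure_ball (0 : R) (ltW (s0 ord0)).
apply: (eq_trans E2); etransitivity.
  apply: congr2; last exact: L2.
  by apply: (eq_trans E1); apply: congr2; [apply: ih|exact: L1].
by rewrite -!EFinM big_ord_recl; congr EFin; ring.
Qed.

End BoxMeasure.

(** * Functions with a pole near the boundary *)

Section PoleFunction.
Context {R : realType} {n : nat}.
Local Notation mu := (lebesgueC n.+1).
Local Notation D := (polydisc R n.+1).

Definition ctr (t : R) (j : 'I_n.+1) : R := if j == ord0 then t else 0.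

Definition wid (s s' : R) (j : 'I_n.+1) : R := if j == ord0 then s else s'.

Lemma wid_gt0 s s' : 0 < s -> 0 < s' -> forall j, 0 < wid s s' j.
Proof. by move=> s0 s'0 j; rewrite /wid; case: ifP. Qed.

Lemma lebesgueC_box_wid (t s s' : R) : 0 < s -> 0 < s' ->
  mu (box (ctr t) (wid s s')) = ((2 * s) ^+ 2 * ((2 * s') ^+ 2) ^+ n)%:E.
Proof.
move=> s0 s'0; rewrite lebesgueC_box; last exact: wid_gt0.
rewrite big_ord_recl /wid eqxx; congr (_ * _)%:E.
by under eq_bigr do rewrite eq_sym (negbTE (neq_lift _ _));
  rewrite prodr_const card_ord.
Qed.

Lemma polydisc_coord_lt1 (z : Cn R n.+1) j : D z ->
  `|complex.Re (z 0 j)| < 1 /\ `|complex.Im (z 0 j)| < 1.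
Proof.
move=> /(_ j); rewrite normc_def ltcR -[X in _ < X]sqrtr1 ltr_sqrt// => h.
split; rewrite -(@ltr_pXn2r _ 2)// ?nnegrE// expr1n real_normK ?num_real//;
  by apply: le_lt_trans h; rewrite ?lerDl ?lerDr sqr_ge0.
Qed.

(** Up to the factor pi, r times the Bergman kernel of the unit disc at the point 1 - r, in the
    variable z_0. The kernel has norm of order 1/r, which the factor r compensates. *)
Definition pole (r : R) (z : Cn R n.+1) : R[i]^o :=
  r%:C * (1 - (1 - r)%:C * z 0 ord0)^-1 ^+ 2.

(** Real part, imaginary part and squared modulus of 1 - (1 - r) z_0, to which the estimates on
    [pole] are reduced. *)
Let qRe (r : R) (z : Cn R n.+1) : R := 1 - (1 - r) * complex.Re (z 0 ord0).
Let qIm (r : R) (z : Cn R n.+1) : R := - (1 - r) * complex.Im (z 0 ord0).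
Let qN (r : R) (z : Cn R n.+1) : R := qRe r z ^+ 2 + qIm r z ^+ 2.

Lemma qE r (z : Cn R n.+1) : 1 - (1 - r)%:C * z 0 ord0 = qRe r z +i* qIm r z :> R[i].
Proof.
rewrite /qRe /qIm; case: (z 0 ord0) => x y; apply/eqP.
by rewrite eq_complex/=; apply/andP; split; apply/eqP; ring.
Qed.

Lemma poleE r (z : Cn R n.+1) : pole r z =
  (r * ((qRe r z / qN r z) ^+ 2 - (qIm r z / qN r z) ^+ 2)) +i*
  (r * - (2 * (qRe r z / qN r z) * (qIm r z / qN r z))).
Proof.
rewrite /pole qE /qN expr2; apply/eqP; rewrite eq_complex/=.
by apply/andP; split; apply/eqP; ring.
Qed.

Lemma normc_pole r (z : Cn R n.+1) : 0 <= r -> normc (pole r z) = r / qN r z.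
Proof.
move=> r0; rewrite /pole normcM expr2 normcM normcV -expr2 exprVn.
by rewrite qE normc_sqrE /= expr0n addr0 sqrtr_sqr ger0_norm.
Qed.

Lemma measurable_pole (A : set (Cn R n.+1)) r :
  measurable_fun A (fun z => complex.Re (pole r z)) /\
  measurable_fun A (fun z => complex.Im (pole r z)).
Proof.
have ma : measurable_fun A (qRe r).
  apply: measurable_funB; first exact: measurable_cst.
  by apply: measurable_funM; [exact: measurable_cst|exact: measurable_ReC].
have mb : measurable_fun A (qIm r).
  by apply: measurable_funM; [exact: measurable_cst|exact: measurable_ImC].
have mN : measurable_fun A (fun z => (qN r z)^-1).
  (* The inverse is taken as a real power, known to be measurable; the two agree because [qN] is
     nonnegative. *)
  have -> : (fun z => (qN r z)^-1) = (fun x => x `^ (-1)) \o qN r.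
    apply/funext => z /=; rewrite powR_inv1//.
    by rewrite addr_ge0 ?sqr_ge0.
  apply: measurableT_comp; first exact: measurable_powR.
  by apply: measurable_funD; exact: measurable_funX.
have maN := measurable_funM ma mN; have mbN := measurable_funM mb mN.
split; under eq_fun do rewrite poleE/=.
- apply: measurable_funM; first exact: measurable_cst.
  by apply: measurable_funB; exact: measurable_funX.
- apply: measurable_funM; first exact: measurable_cst.
  apply: measurable_funN; apply: measurable_funM => //.
  by apply: measurable_funM => //; exact: measurable_cst.
Qed.

Lemma qRe_gt0 r (z : Cn R n.+1) : 0 < r -> r <= 1 -> D z -> r <= qRe r z.
Proof.
move=> r0 r1 /polydisc_coord_lt1 => /(_ ord0)[+ _].
rewrite ltr_norml /qRe => /andP[h1 h2].
have : (1 - r) * complex.Re (z 0 ord0) <= (1 - r) * 1.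
  by apply: ler_wpM2l; [rewrite subr_ge0|exact: ltW].
lra.
Qed.

Lemma differentiable_pole r (z : Cn R n.+1) : 0 < r -> r <= 1 -> D z ->
  differentiable (pole r) z.
Proof.
move=> r0 r1 Dz; pose q (z : Cn R n.+1) : R[i]^o := 1 - (1 - r)%:C * z 0 ord0.
have dq : differentiable q z.
  apply: differentiableB; first exact: differentiable_cst.
  apply: differentiableM; first exact: differentiable_cst.
  exact: differentiable_coord.
have q0 : q z != 0.
  rewrite /q qE eq_complex/= negb_and; apply/orP; left.
  by rewrite gt_eqF// (lt_le_trans r0)// qRe_gt0.
have dV : differentiable (fun z => (q z)^-1) z by exact: differentiableV.
apply: differentiableM; first exact: differentiable_cst.
exact: (differentiableM dV dV).
Qed.

Lemma sum_geometric_quarter (N : nat) : \sum_(k < N) (1 / 4 : R) ^+ k <= 2.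
Proof.
have -> : \sum_(k < N) (1 / 4 : R) ^+ k = 4 / 3 * (1 - (1 / 4) ^+ N).
  elim: N => [|N ih]; first by rewrite big_ord0 expr0 subrr mulr0.
  by rewrite big_ord_recr/= ih exprSr; field.
have : 0 <= (1 / 4 : R) ^+ N by apply: exprn_ge0; lra.
lra.
Qed.

(** Since 1 - r >= 1/2, the imaginary part of z_0 shrinks at most by half, and 1 - (1 - r) x >= (1 -
    x) / 2 whatever the sign of x. *)
Lemma qN_ge_far r d (z : Cn R n.+1) : 0 < r -> r <= 1 / 2 -> 0 <= d -> D z ->
  d <= `|complex.Re (z 0 ord0) - 1| \/ d <= `|complex.Im (z 0 ord0)| ->
  d ^+ 2 / 4 <= qN r z.
Proof.
move=> r0 r12 d0 Dz; have [] := polydisc_coord_lt1 ord0 Dz.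
rewrite /qN /qRe /qIm.
move: (complex.Re (z 0 ord0)) (complex.Im (z 0 ord0)) => x y.
rewrite ltr_norml => /andP[x1 x2] y1 h.
have sq (u : R) : d / 2 <= `|u| -> d ^+ 2 / 4 <= u ^+ 2.
  move=> du; rewrite -(real_normK (num_real u)).
  have -> : d ^+ 2 / 4 = (d / 2) ^+ 2 by field.
  by rewrite ler_pXn2r ?nnegrE//; lra.
case: h => h.
  apply: (@le_trans _ _ ((1 - (1 - r) * x) ^+ 2)); last by rewrite lerDl sqr_ge0.
  apply: sq; apply: le_trans (ler_norm _).
  move: h; rewrite ltr0_norm; last by lra.
  move=> h; have [x0|x0] := leP 0 x; first by nra.
  by nra.
apply: (@le_trans _ _ ((- (1 - r) * y) ^+ 2)); last by rewrite lerDr sqr_ge0.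
apply: sq; rewrite mulNr normrN normrM ger0_norm; last by lra.
nra.
Qed.

Lemma sqnorm_pole_le (m : nat) (r : R) : r = (1 / 2) ^+ m.+1 ->
  (sqnorm_L2 D (pole r) <= (2048 * 4 ^+ n)%:E)%E.
Proof.
move=> rE.
have r0 : 0 < r by rewrite rE exprn_gt0//; lra.
have r12 : r <= 1 / 2.
  rewrite rE exprS -[leRHS]mulr1; apply: ler_wpM2l; first by lra.
  by apply: exprn_ile1; lra.
have r1 : r <= 1 by lra.
(* Dyadic boxes around the singularity z_0 = 1: on A k \ A (k - 1) the function
   has modulus at most 16 / (4^k r), while A k has volume of order 4^k r^2. *)
pose sk (k : nat) : R := 2 ^+ k * r.
have sk0 k : 0 < sk k by rewrite mulr_gt0 ?exprn_gt0.
pose A k := box (ctr 1) (wid (sk k) 1) : set (Cn R n.+1).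
have mA k : measurable (A k) by exact: measurable_box.
pose coef k : R := 256 * r ^+ 2 / sk k ^+ 4.
have coef0 k : 0 <= coef k by rewrite !mulr_ge0 ?invr_ge0 ?exprn_ge0// ltW.
have Dbox z j : D z -> j != ord0 ->
    `|complex.Re (z 0 j) - 0| < 1 /\ `|complex.Im (z 0 j)| < 1.
  by move=> Dz _; rewrite subr0; exact: polydisc_coord_lt1.
have pt z : D z -> normc (pole r z) ^+ 2 <=
    \sum_(k < m.+3) coef k * \1_(A k) z.
  move=> Dz.
  (* The half-width 2^(m+2) r equals 2, so the last box covers the polydisc; this fixes the number
     [m.+3] of boxes. Only the term of the smallest box containing z is used below. *)
  have Am : A m.+2 z.
    move=> j; rewrite /ctr /wid.
    have [->|j0] := eqVneq j ord0; last exact: Dbox.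
    have -> : sk m.+2 = 2.
      rewrite /sk rE exprS -mulrA -exprMn.
      by rewrite mul1r divff// expr1n mulr1.
    have [] := polydisc_coord_lt1 ord0 Dz.
    rewrite !ltr_norml => /andP[h1 h2] /andP[h3 h4].
    by split; apply/andP; split; lra.
  have exA : exists k, `[< A k z >] by exists m.+2; apply/asboolP.
  case: (ex_minnP exA) => k /asboolP Ak kmin.
  have km : (k < m.+3)%N by rewrite ltnS; apply: kmin; exact/asboolP.
  rewrite (bigD1 (Ordinal km))//= indicE mem_set// mulr1.
  apply: ler_wpDr.
    by apply: sumr_ge0 => i _; rewrite mulr_ge0// indicE.
  (* For k = 0, [qRe_gt0] suffices. Otherwise z lies outside the preceding box, and [qN_ge_far]
     applies with d half of [sk k]. *)
  have NP : sk k ^+ 2 / 16 <= qN r z.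
    case: k {Ak km} kmin => [_|k kmin].
      have := qRe_gt0 r0 r1 Dz; rewrite /qN /sk mul1r => h.
      apply: (@le_trans _ _ (qRe r z ^+ 2)); last by rewrite lerDl sqr_ge0.
      apply: (@le_trans _ _ (r ^+ 2)).
        by rewrite ler_piMr ?sqr_ge0//; lra.
      by rewrite ler_pXn2r ?nnegrE// ltW// (lt_le_trans r0).
    have nA : ~ A k z.
      by move=> /asboolP /kmin; rewrite ltnn.
    have [j hj] := not_boxP nA.
    have j0 : j = ord0.
      apply/eqP/negPn/negP => j0; have [h1 h2] := Dbox z j Dz j0.
      move: hj; rewrite /ctr /wid (negbTE j0) => -[|]; rewrite leNgt.
        by rewrite h1.
      by rewrite h2.
    rewrite j0 /ctr /wid eqxx in hj.
    have := qN_ge_far r0 r12 (ltW (sk0 k)) Dz hj; apply: le_trans.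
    by rewrite /sk (exprS 2 k) le_eqVlt; apply/orP; left; apply/eqP; field.
  have P0 : 0 < sk k ^+ 2 / 16 by rewrite divr_gt0 ?exprn_gt0.
  have N0 : 0 < qN r z := lt_le_trans P0 NP.
  rewrite normc_pole ?(ltW r0)// /coef.
  have -> : 256 * r ^+ 2 / sk k ^+ 4 = (r / (sk k ^+ 2 / 16)) ^+ 2.
    by field; rewrite gt_eqF.
  rewrite ler_pXn2r ?nnegrE ?divr_ge0 ?sqr_ge0 ?(ltW r0) ?(ltW N0)//.
  by rewrite ler_pM2l// lef_pV2 ?posrE.
have mpole := measurable_pole D r.
have le1 : (sqnorm_L2 D (pole r) <= \int[mu]_(z in D)
    (\sum_(k < m.+3) (coef k)%:E * (\1_(A k) z)%:E))%E.
  apply: ge0_le_integral.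
  - exact: polydisc_measurable.
  - by move=> z _; rewrite lee_fin sqr_ge0.
  - by apply/measurable_EFinP; apply: measurable_normc_sqr; case: mpole.
  - apply: emeasurable_sum => k; apply/measurable_EFinP.
    by apply: measurable_funM; [exact: measurable_cst|exact: measurable_indic].
  - move=> z Dz; rewrite sumEFin lee_fin.
    exact: pt.
apply: (le_trans le1).
rewrite ge0_integral_sum; last 3 first.
- exact: polydisc_measurable.
- move=> k; apply/measurable_EFinP.
  by apply: measurable_funM; [exact: measurable_cst|exact: measurable_indic].
- by move=> k z _; rewrite lee_fin mulr_ge0// indicE.
(* Coefficient times volume is (256 r^2 / s^4) (4 s^2) 4^n with s = 2^k r, that is 1024 4^n 4^-k. *)
apply: (@le_trans _ _ (\sum_(k < m.+3) (1024 * 4 ^+ n * (1 / 4) ^+ k)%:E)%E).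
  apply: lee_sum => k _.
  rewrite ge0_integralZl_EFin//; last 2 first.
  - exact: polydisc_measurable.
  - by apply/measurable_EFinP; exact: measurable_indic.
  rewrite integral_indic//; last exact: polydisc_measurable.
  apply: (@le_trans _ _ ((coef k)%:E * mu (A k))%E).
    apply: lee_wpmul2l; first by rewrite lee_fin.
    apply: le_measure; rewrite ?inE//.
    by apply: measurableI => //; exact: polydisc_measurable.
  rewrite lebesgueC_box_wid// -EFinM lee_fin.
  have -> : (2 * 1 : R) ^+ 2 = 4 by ring.
  rewrite le_eqVlt; apply/orP; left; apply/eqP.
  rewrite /coef /sk.
  have -> : (1 / 4 : R) ^+ k = (2 ^+ k)^-1 ^+ 2.
    by rewrite -exprVn -exprM mulnC exprM; congr (_ ^+ _); field.
  field; rewrite (gt_eqF r0) expf_eq0/= pnatr_eq0 andbF.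
  by [].
rewrite sumEFin lee_fin -mulr_sumr.
have -> : 2048 * 4 ^+ n = 1024 * 4 ^+ n * 2 :> R by ring.
apply: ler_wpM2l; last exact: sum_geometric_quarter.
by apply: mulr_ge0; [exact: ler0n|apply: exprn_ge0; exact: ler0n].
Qed.

(** On this box 1 - (1 - r) z_0 is of size r with imaginary part at most r/4, so its argument is
    small and the inverse square keeps a real part of order r^-2. *)
Lemma Re_pole_ge r (z : Cn R n.+1) : 0 < r -> r <= 1 / 2 ->
  box (ctr (1 - r)) (wid (r / 4) (1 / 2)) z ->
  1 / (20 * r) <= complex.Re (pole r z).
Proof.
move=> r0 r12 /(_ ord0); rewrite /ctr /wid eqxx poleE/= /qN.
have : qRe r z = 1 - (1 - r) * complex.Re (z 0 ord0) by [].
have : qIm r z = - (1 - r) * complex.Im (z 0 ord0) by [].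
move: (complex.Re (z 0 ord0)) (complex.Im (z 0 ord0)) (qRe r z) (qIm r z).
move=> x y a b eb ea [].
rewrite !ltr_norml => /andP[x1 x2] /andP[y1 y2].
have r1 : 0 <= 1 - r by lra.
have h1 : (1 - r) * x <= (1 - r) * (1 - 3 / 4 * r) by apply: ler_wpM2l => //; lra.
have h2 : (1 - r) * (1 - 5 / 4 * r) <= (1 - r) * x by apply: ler_wpM2l => //; lra.
have rr : 0 <= r ^+ 2 by exact: sqr_ge0.
have rr2 : r ^+ 2 <= r / 2 by rewrite expr2; nra.
(* From x < 1 - 3r/4 one gets a >= 7r/4 - 3r^2/4, and r^2 <= r/2 leaves 11r/8. *)
have a1 : 11 / 8 * r <= a by rewrite ea; nra.
have a2 : a <= 9 / 4 * r by rewrite ea; nra.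
have b1 : b ^+ 2 <= (r / 4) ^+ 2.
  rewrite -real_normK ?num_real// ler_pXn2r ?nnegrE//; last by lra.
  rewrite ler_norml eb; apply/andP; split; nra.
have a1s : (11 / 8 * r) ^+ 2 <= a ^+ 2 by rewrite ler_pXn2r ?nnegrE//; lra.
have a2s : a ^+ 2 <= (9 / 4 * r) ^+ 2 by rewrite ler_pXn2r ?nnegrE//; lra.
have b0 := sqr_ge0 b.
set N := a ^+ 2 + b ^+ 2.
have r2 : 0 < r ^+ 2 by rewrite exprn_gt0.
have N0 : 0 < N by rewrite /N; move: a1s; rewrite exprMn; lra.
have N1 : N <= 41 / 8 * r ^+ 2 by rewrite /N; move: a2s b1; rewrite !exprMn; lra.
have num : 9 / 5 * r ^+ 2 <= a ^+ 2 - b ^+ 2.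
  by move: a1s b1; rewrite !exprMn; lra.
have -> : r * ((a / N) ^+ 2 - (b / N) ^+ 2) = r * (a ^+ 2 - b ^+ 2) / N ^+ 2.
  by field; rewrite gt_eqF.
have NN : N ^+ 2 <= (41 / 8 * r ^+ 2) ^+ 2.
  by rewrite ler_pXn2r ?nnegrE ?(ltW N0)//; lra.
rewrite ler_pdivlMr ?exprn_gt0//.
apply: (@le_trans _ _ (1 / (20 * r) * (41 / 8 * r ^+ 2) ^+ 2)).
  by apply: ler_wpM2l => //; rewrite divr_ge0//; lra.
apply: (@le_trans _ _ (r * (9 / 5 * r ^+ 2))); last by rewrite ler_wpM2l// ltW.
have -> : 1 / (20 * r) * (41 / 8 * r ^+ 2) ^+ 2 = r * (1681 / 1280 * r ^+ 2).
  by field; rewrite gt_eqF.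
by apply: ler_wpM2l; [exact: ltW|nra].
Qed.

End PoleFunction.

(** * Cauchy-Schwarz localised to the support of one factor *)

Section Localization.
Context {R : realType} {n : nat} (D : set (Cn R n)) (mD : measurable D).
Local Notation mu := (lebesgueC n).

Lemma sqnorm_L2_supported_le (B : set (Cn R n)) (f : Cn R n -> R[i]^o)
    (C v : R) : measurable B -> mu B = v%:E ->
  measurable_fun D (fun z => complex.Re (f z)) ->
  measurable_fun D (fun z => complex.Im (f z)) ->
  (forall z, normc (f z) <= C) -> (forall z, ~ B z -> f z = 0) ->
  (sqnorm_L2 D f <= (C ^+ 2 * v)%:E)%E.
Proof.
move=> mB vB mRe mIm fC f0.
have h : (sqnorm_L2 D f <= \int[mu]_(z in D) ((C ^+ 2)%:E * (\1_B z)%:E))%E.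
  apply: ge0_le_integral => //.
  - by move=> z _; rewrite lee_fin sqr_ge0.
  - by apply/measurable_EFinP; exact: measurable_normc_sqr.
  - apply/measurable_EFinP.
    by apply: measurable_funM; [exact: measurable_cst|exact: measurable_indic].
  - move=> z Dz; rewrite lee_fin indicE.
    have [zB|zB] := boolP (z \in B).
      rewrite mulr1 ler_pXn2r ?nnegrE ?normc_ge0//.
      exact: le_trans (normc_ge0 _) (fC z).
    rewrite f0; first by rewrite normc0 expr0n mulr0.
    by move: zB => /negP zB Bz; apply: zB; exact: mem_set.
apply: (le_trans h).
rewrite ge0_integralZl_EFin//; last 2 first.
- by apply/measurable_EFinP; exact: measurable_indic.
- exact: sqr_ge0.
rewrite integral_indic// (EFinM _ v); apply: lee_wpmul2l; first by rewrite lee_fin sqr_ge0.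
rewrite -vB; apply: le_measure; rewrite ?inE//; exact: measurableI.
Qed.

(** Cutting [u] off outside [B] leaves the integral unchanged, and conjugating [w] turns it into an
    inner product. The cut-off lets disjoint boxes be charged to disjoint parts of the norm of
    [u]. *)
Lemma cintegral_supported_cauchy_schwarz (B : set (Cn R n))
    (u w : Cn R n -> R[i]^o) : measurable B -> in_L2 D u -> in_L2 D w ->
  (forall z, ~ B z -> w z = 0) ->
  ((normc (cintegral D (fun z => u z * w z)) ^+ 2)%:E <=
   sqnorm_L2 D w * sqnorm_L2 (D `&` B) u)%E.
Proof.
move=> mB u2 w2 w0.
pose u' : Cn R n -> R[i]^o := fun z => if z \in B then u z else 0.
pose w' : Cn R n -> R[i]^o := fun z => Num.conj (w z).
have [u2a u2b u2c] := u2; have [w2a w2b w2c] := w2.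
have nu' : (fun z => (normc (u' z) ^+ 2)%:E) =
    (fun z => (normc (u z) ^+ 2)%:E) \_ B.
  apply/funext => z; rewrite /u' patchE; case: ifP => // _.
  by rewrite normc0 expr0n.
have su' : sqnorm_L2 D u' = sqnorm_L2 (D `&` B) u.
  by rewrite /sqnorm_L2 nu' -integral_mkcondr.
have u'2 : in_L2 D u'.
  have mpart (h : R[i] -> R) : h 0 = 0 -> measurable_fun D (fun z => h (u z)) ->
      measurable_fun D (fun z => h (u' z)).
    move=> h0 mh.
    have -> : (fun z => h (u' z)) = (fun z => h (u z) * \1_B z).
      apply/funext => z; rewrite /u' indicE; case: (z \in B) => /=.
        by rewrite mulr1.
      by rewrite mulr0 h0.
    by apply: measurable_funM => //; exact: measurable_indic.
  split; [exact: (mpart (@complex.Re R))|exact: (mpart (@complex.Im R))|].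
  rewrite su'; apply: le_lt_trans u2c; apply: ge0_subset_integral => //.
  - exact: measurableI.
  - by apply/measurable_EFinP; exact: measurable_normc_sqr.
  - by move=> z _; rewrite lee_fin sqr_ge0.
have nw' z : normc (w' z) = normc (w z).
  by rewrite /w'; case: (w z) => a b /=; rewrite sqrrN.
have sw' : sqnorm_L2 D w' = sqnorm_L2 D w.
  by apply: eq_integral => z _; rewrite nw'.
have w'2 : in_L2 D w'.
  split; last by rewrite sw'.
  - by apply: eq_measurable_fun w2a => z _; rewrite /w'; case: (w z).
  - apply: (eq_measurable_fun (fun z => - complex.Im (w z))).
      by move=> z _; rewrite /w'; case: (w z).
    exact: measurable_funN.
have uw : (fun z => u z * w z) = (fun z => u' z * (w' z)^*).
  apply/funext => z.
  have -> : Num.conj (w' z) = w z by rewrite /w' conjCK.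
  rewrite /u'; have [//|zB] := boolP (z \in B); rewrite w0 ?mulr0//.
  by move: zB => /negP zB Bz; apply: zB; exact: mem_set.
have -> : cintegral D (fun z => u z * w z) = inner_L2 D u' w' by rewrite uw.
rewrite -su' -sw' !sqnorm_L2E// -EFinM lee_fin mulrC.
exact: cauchy_schwarz_L2.
Qed.

End Localization.

(** * The bump near the pole and its pairing with [pole] *)

Section PoleTest.
Context {R : realType} {n : nat}.
Local Notation mu := (lebesgueC n.+1).
Local Notation D := (polydisc R n.+1).
Implicit Types r : R.

Let c r := ctr (n := n) (1 - r).
Let s r := wid (n := n) (r / 4) (1 / 2).

Definition pole_box r : set (Cn R n.+1) := box (c r) (s r).

Definition pole_bump r : Cn R n.+1 -> R[i]^o := fun z => (box_hat (c r) (s r) z)%:C.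

Let s_gt0 r : 0 < r -> forall j, 0 < s r j.
Proof. by move=> r0; apply: wid_gt0; lra. Qed.

(** In z_0 the worst corner has squared modulus (1 - 3r/4)^2 + (r/4)^2 < 1; in the other coordinates
    it is at most 1/2. *)
Lemma pole_box_subset r : 0 < r -> r <= 1 / 2 -> closed_box (c r) (s r) `<=` D.
Proof.
move=> r0 r12 z hz j; have := hz j; rewrite /c /s /ctr /wid normc_def ltcR.
rewrite -[X in _ -> _ < X]sqrtr1 ltr_sqrt//.
move: (complex.Re (z 0 j)) (complex.Im (z 0 j)) => x y.
case: ifP => _ [].
  rewrite !ler_norml => /andP[x1 x2] /andP[y1 y2].
  have : y ^+ 2 <= (r / 4) ^+ 2.
    by rewrite -(real_normK (num_real y)) ler_pXn2r ?nnegrE ?ler_norml ?y1//; lra.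
  have : x ^+ 2 <= (1 - 3 / 4 * r) ^+ 2.
    rewrite -(real_normK (num_real x)) ler_pXn2r ?nnegrE//; last by lra.
    by rewrite ler_norml; apply/andP; split; lra.
  nra.
rewrite subr0 => hx hy.
have sq (u : R) : `|u| <= 1 / 2 -> u ^+ 2 <= 1 / 4.
  move=> hu; rewrite -(real_normK (num_real u)).
  have -> : 1 / 4 = (1 / 2) ^+ 2 :> R by field.
  by rewrite ler_pXn2r ?nnegrE//; lra.
have := sq _ hx; have := sq _ hy; lra.
Qed.

Lemma test_function_pole_bump r : 0 < r -> r <= 1 / 2 ->
  test_function D (pole_bump r).
Proof.
move=> r0 r12; apply: test_function_box_hat; first exact: s_gt0.
exact: pole_box_subset.
Qed.

Lemma measurable_pole_box r : measurable (pole_box r).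
Proof. exact: measurable_box. Qed.

Lemma lebesgueC_pole_box r : 0 < r -> mu (pole_box r) = (r ^+ 2 / 4)%:E.
Proof.
move=> r0; rewrite lebesgueC_box_wid; [congr EFin|lra|lra].
have -> : (2 * (1 / 2)) ^+ 2 = 1 :> R by field.
by rewrite expr1n; field.
Qed.

Lemma sqnorm_pole_bump_le r : 0 < r ->
  in_L2 D (pole_bump r) /\ (sqnorm_L2 D (pole_bump r) <= (r ^+ 2 / 4)%:E)%E.
Proof.
move=> r0.
have mRe : measurable_fun D (fun z => complex.Re (pole_bump r z)).
  by apply: measurable_flat_alg; exact: flat_alg_box_hat.
have mIm : measurable_fun D (fun z => complex.Im (pole_bump r z)).
  exact: measurable_cst.
have h : (sqnorm_L2 D (pole_bump r) <= (1 ^+ 2 * (r ^+ 2 / 4))%:E)%E.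
  apply: (@sqnorm_L2_supported_le R n.+1 D (@polydisc_measurable R n.+1) (pole_box r)
    (pole_bump r) 1 (r ^+ 2 / 4)) => //.
  - exact: measurable_pole_box.
  - exact: lebesgueC_pole_box.
  - move=> z; rewrite /= expr0n addr0 sqrtr_sqr ger0_norm ?box_hat_ge0//.
    exact: box_hat_le1.
  - by move=> z hz; rewrite /pole_bump box_hat_eq0//; exact: s_gt0.
rewrite expr1n mul1r in h; split=> //; split=> //.
by apply: le_lt_trans h _; exact: ltry.
Qed.

(** Away from z_0 the width is 1/2 for every r, so the derivative is uniformly bounded and the
    factor r^2 is the volume of the support. *)
Lemma sqnorm_dbar_pole_bump (j : 'I_n.+1) : j != ord0 -> exists2 C : R, 0 < C &
  forall r, 0 < r -> in_L2 D (dbar j (pole_bump r)) /\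
    (sqnorm_L2 D (dbar j (pole_bump r)) <= (C * r ^+ 2)%:E)%E.
Proof.
move=> j0; have [C C0 hC] := @normc_dbar_box_hat R n.+1.
(* 2C bounds the derivative at width 1/2, and 1/4 comes from the volume r^2 / 4; the summand 1 makes
   the constant positive even for [C = 0]. *)
exists ((2 * C) ^+ 2 / 4 + 1); first by rewrite ltr_wpDl// divr_ge0 ?sqr_ge0.
move=> r r0.
have [mRe mIm] := measurable_dbar_real D j (flat_alg_box_hat (c r) (s r)).
have h : (sqnorm_L2 D (dbar j (pole_bump r)) <= ((2 * C) ^+ 2 * (r ^+ 2 / 4))%:E)%E.
  apply: (@sqnorm_L2_supported_le R n.+1 D (@polydisc_measurable R n.+1) (pole_box r)
    (dbar j (pole_bump r)) (2 * C) (r ^+ 2 / 4)) => //.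
  - exact: measurable_pole_box.
  - exact: lebesgueC_pole_box.
  - move=> z; apply: le_trans (hC _ _ _ _ (s_gt0 r0)) _.
    rewrite /s /wid (negbTE j0) le_eqVlt; apply/orP; left; apply/eqP.
    by field.
  - by move=> z hz; rewrite /pole_bump dbar_box_hat_eq0//; exact: s_gt0.
have h' : (sqnorm_L2 D (dbar j (pole_bump r)) <=
    (((2 * C) ^+ 2 / 4 + 1) * r ^+ 2)%:E)%E.
  apply: (le_trans h); rewrite lee_fin -subr_ge0.
  have -> : ((2 * C) ^+ 2 / 4 + 1) * r ^+ 2 - (2 * C) ^+ 2 * (r ^+ 2 / 4) = r ^+ 2.
    by field.
  exact: sqr_ge0.
split=> //; split=> //.
by apply: le_lt_trans h' _; exact: ltry.
Qed.

Lemma in_A2_pole (m : nat) r : r = (1 / 2) ^+ m.+1 -> in_A2 D (pole r).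
Proof.
move=> rE.
have r0 : 0 < r by rewrite rE exprn_gt0//; lra.
have r1 : r <= 1 by rewrite rE; apply: exprn_ile1; lra.
split; last by move=> z Dz; exact: differentiable_pole.
have [mRe mIm] := measurable_pole D r; split=> //.
by apply: le_lt_trans (sqnorm_pole_le rE) _; exact: ltry.
Qed.

(** The real part of the integrand is nonnegative, so it may be integrated over the half-size box
    alone, where both factors are bounded below. *)
Lemma inner_pole_pole_bump : exists2 k : R, 0 < k & forall (m : nat) r,
  r = (1 / 2) ^+ m.+1 -> k * r <= normc (inner_L2 D (pole r) (pole_bump r)).
Proof.
pose k0 := (flat 1 (1 / 2 : R) ^+ 2 * flat 1 (1 / 2) ^+ 2) ^+ n.+1.
have k00 : 0 < k0.
  have f0 : 0 < flat 1 (1 / 2 : R) by apply: flat1_gt0; lra.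
  by rewrite exprn_gt0// mulr_gt0 ?exprn_gt0.
have q0 : 0 < ((2 * (1 / 4)) ^+ 2 : R) ^+ n by do 2 apply: exprn_gt0; lra.
(* The height k0 / (20 r) times the volume of [B], whose z_0-factor is (r/4)^2: hence 320 = 20 16
   and one remaining power of r. *)
exists (k0 * ((2 * (1 / 4)) ^+ 2) ^+ n / 320).
  by rewrite divr_gt0 ?mulr_gt0.
move=> m r rE.
have r0 : 0 < r by rewrite rE exprn_gt0//; lra.
have r12 : r <= 1 / 2.
  rewrite rE exprS -[leRHS]mulr1; apply: ler_wpM2l; first by lra.
  by apply: exprn_ile1; lra.
have pole2 : in_L2 D (pole r) by exact: (in_A2_pole rE).1.
have [bump2 _] := sqnorm_pole_bump_le r0.
pose B : set (Cn R n.+1) := box (c r) (wid (r / 8) (1 / 4)).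
have mB : measurable B by exact: measurable_box.
have mD := @polydisc_measurable R n.+1.
have vB : mu B = ((r / 4) ^+ 2 * ((2 * (1 / 4)) ^+ 2) ^+ n)%:E.
  rewrite lebesgueC_box_wid; [|lra|lra].
  by congr (_ ^+ 2 * _)%:E; field.
have BD : B `<=` D.
  move=> z hz; apply: (pole_box_subset r0 r12) => j.
  have := hz j; rewrite /s /wid; case: ifP => _ [h1 h2]; split; lra.
have BhalfE z : B z -> box (c r) (fun j => s r j / 2) z.
  move=> hz j; have := hz j; rewrite /s /wid; case: ifP => _.
    by have -> : r / 4 / 2 = r / 8 by field.
  by have -> : 1 / 2 / 2 = 1 / 4 :> R by field.
have BBox z : B z -> pole_box r z.
  move=> hz j; have := hz j; rewrite /s /wid; case: ifP => _ [h1 h2]; split; lra.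
apply: (@le_trans _ _ (complex.Re (inner_L2 D (pole r) (pole_bump r)))); last first.
  apply: le_trans (ler_norm _) _.
  case: (inner_L2 _ _ _) => a b /=.
  by rewrite -sqrtr_sqr ler_sqrt ?addr_ge0 ?sqr_ge0// lerDl sqr_ge0.
have [iRe _] := cintegrable_inner mD pole2 bump2.
have -> : k0 * ((2 * (1 / 4)) ^+ 2) ^+ n / 320 * r =
    1 / (20 * r) * k0 * fine (mu B).
  by rewrite vB /=; field; rewrite gt_eqF.
rewrite -Rintegral_cst// -[X in \int[mu]_(_ in X) _](setIidr BD) Rintegral_mkcondr.
apply: le_Rintegral => //.
  apply: (@eq_integrable _ _ _ mu D mD (fun z => (1 / (20 * r) * k0 * \1_B z)%:E)).
    move=> z _; rewrite /= patchE indicE; case: (z \in B) => /=.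
      by rewrite mulr1.
    by rewrite mulr0.
  apply: (@integrableZl _ _ _ mu D mD (1 / (20 * r) * k0) (fun z => (\1_B z)%:E)).
  apply/integrableP; split.
    by apply/measurable_EFinP; exact: measurable_indic.
  rewrite (eq_integral (fun z => (\1_B z)%:E)); last first.
    by move=> z _; rewrite gee0_abs// lee_fin indicE.
  rewrite integral_indic// (setIidl BD).
  by rewrite vB ltry.
move=> z Dz.
have -> : complex.Re (pole r z * (pole_bump r z)^*) =
    complex.Re (pole r z) * box_hat (c r) (s r) z.
  by rewrite /pole_bump; case: (pole r z) => a b /=; rewrite oppr0 mulr0 subr0.
rewrite patchE; case: ifPn => [/set_mem zB|_].
  apply: ler_pM.
  - by rewrite divr_ge0// ltW// mulr_gt0.
  - exact: ltW.
  - by apply: Re_pole_ge => //; exact: BBox.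
  - by apply: box_hat_ge; [exact: s_gt0|exact: BhalfE].
(* Outside [B] nonnegativity suffices: [pole] has positive real part on the whole support of the
   bump. *)
have [hz|hz] := pselect (pole_box r z).
  rewrite mulr_ge0 ?box_hat_ge0//; apply: le_trans (Re_pole_ge r0 r12 hz).
  by rewrite divr_ge0// ltW// mulr_gt0.
by rewrite box_hat_eq0 ?mulr0//; exact: s_gt0.
Qed.

(** The real part of z_0 ranges over (1 - 5r/4, 1 - 3r/4). For r' <= r/2 one has 1 - 5r'/4 >= 1 -
    5r/8 > 1 - 3r/4, so these intervals are disjoint. *)
Lemma trivIset_pole_box : trivIset setT (fun m : nat => pole_box ((1 / 2) ^+ m.+1)).
Proof.
have far (a b : nat) z : (a < b)%N -> pole_box ((1 / 2) ^+ a.+1) z ->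
    pole_box ((1 / 2) ^+ b.+1) z -> False.
  move=> ab /(_ ord0)[+ _] /(_ ord0)[+ _].
  rewrite /c /s /ctr /wid eqxx !ltr_norml => /andP[h1 h2] /andP[h3 h4].
  have : (1 / 2 : R) ^+ b.+1 <= (1 / 2) ^+ a.+2.
    by apply: ler_wiXn2l; [lra|lra|rewrite !ltnS].
  rewrite (exprS _ a.+1).
  have : 0 < (1 / 2 : R) ^+ a.+1 by apply: exprn_gt0; lra.
  lra.
move=> a b _ _ [z [za zb]]; have [ab|ab|//] := ltngtP a b.
  by case: (far a b z ab za zb).
by case: (far b a z ab zb za).
Qed.

End PoleTest.

(** * Divergence of the Hilbert-Schmidt sum *)

Section CanonicalOperator.
Context {R : realType} {n : nat}.
Local Notation D := (polydisc R n.+1).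
Variables (S : @form01 R n.+1 -> Cn R n.+1 -> R[i]^o) (I : choiceType)
  (e : I -> @form01 R n.+1).
Hypothesis Ssol : is_canonical_solution_operator D S.
Hypothesis eonb : orthonormal_basis_A2_01 D e.

Let mass (m : nat) (i : I) : \bar R :=
  sqnorm_L2 (D `&` pole_box ((1 / 2) ^+ m.+1)) (S (e i)).

Let mass_ge0 m i : (0 <= mass m i)%E.
Proof. by apply: integral_ge0 => z _; rewrite lee_fin sqr_ge0. Qed.

(** The functional <-, [pole_bump r]> has mass at least (k r)^2 / (8 (K + 1)) on the basis, and each
    term costs at most C r^2 times the local mass of [S (e i)]; the quotient [delta] is free of
    r. *)
Lemma mass_pole_box (j : 'I_n.+1) : j != ord0 -> exists2 delta : R, 0 < delta &
  forall m, exists2 s : seq I, uniq s & (delta%:E <= \sum_(i <- s) mass m i)%E.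
Proof.
move=> j0; have [C C0 hC] := @sqnorm_dbar_pole_bump R n j j0.
have [k k0 hk] := @inner_pole_pole_bump R n.
pose K : R := 2048 * 4 ^+ n.
have K0 : 0 <= K by rewrite /K; apply: mulr_ge0; [exact: ler0n|apply: exprn_ge0; exact: ler0n].
have K1 : 0 < K + 1 by rewrite ltr_wpDl.
exists (k ^+ 2 / (8 * (K + 1)) / C).
  by rewrite !divr_gt0 ?exprn_gt0// mulr_gt0.
move=> m; rewrite /mass; set r : R := (1 / 2) ^+ m.+1.
have rE : r = (1 / 2) ^+ m.+1 by [].
have r0 : 0 < r by rewrite /r exprn_gt0//; lra.
have r12 : r <= 1 / 2.
  rewrite rE exprS -[leRHS]mulr1; apply: ler_wpM2l; first by lra.
  by apply: exprn_ile1; lra.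
have mD := @polydisc_measurable R n.+1.
(* The coefficient has its pole in z_0 but is placed in the component j <> 0. *)
pose F : @form01 R n.+1 := fun i => if i == j then pole r else fun=> 0.
have FA : in_A2_01 D F.
  move=> i; rewrite /F; case: ifP => _; first exact: (in_A2_pole rE).
  by split; [exact: in_L20|move=> z _; exact: differentiable_cst].
have FK : complex.Re (inner_form D F F) <= K.
  have -> : inner_form D F F = inner_L2 D (pole r) (pole r).
    rewrite /inner_form (bigD1 j)//= big1 ?addr0; first by rewrite /F eqxx.
    by move=> i /negbTE ij; rewrite /F ij inner_L20.
  by rewrite -lee_fin -sqnorm_L2E//; [exact: sqnorm_pole_le|exact: (in_A2_pole rE).1].
have [bump2 _] := sqnorm_pole_bump_le (n := n) r0.
have [dbar2 dbarC] := hC r r0.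
have kF : k * r <= normc (inner_L2 D (F j) (pole_bump r)).
  by rewrite /F eqxx; exact: (hk m).
have [s us hs] := basis_functional_mass mD eonb FA bump2 (mulr_gt0 k0 r0) kF FK.
exists s => //.
have one i : ((normc (inner_L2 D (e i j) (pole_bump r)) ^+ 2)%:E <=
    (C * r ^+ 2)%:E * sqnorm_L2 (D `&` pole_box r) (S (e i)))%E.
  have [eA _ _] := eonb; have [S2 Sweak _] := Ssol (eA i).
  (* The weak equation tested on the bump, which is real and so equals its own conjugate. *)
  have -> : inner_L2 D (e i j) (pole_bump r) =
      - cintegral D (fun z => S (e i) z * dbar j (pole_bump r) z).
    rewrite (Sweak _ (test_function_pole_bump r0 r12) j) opprK.
    rewrite /inner_L2; congr cintegral; apply/funext => z.
    by congr (_ * _); apply/eqP; rewrite eq_complex /= oppr0 !eqxx.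
  rewrite normcN.
  apply: (le_trans (cintegral_supported_cauchy_schwarz mD (measurable_pole_box r) S2 dbar2 _)).
    move=> z hz; rewrite /pole_bump dbar_box_hat_eq0//.
    by apply: wid_gt0; lra.
  apply: lee_wpmul2r => //.
  by apply: integral_ge0 => z _; rewrite lee_fin sqr_ge0.
have Cr0 : 0 < C * r ^+ 2 by rewrite mulr_gt0 ?exprn_gt0.
have -> : (k ^+ 2 / (8 * (K + 1)) / C)%:E =
    ((C * r ^+ 2)^-1%:E * ((k * r) ^+ 2 / (8 * (K + 1)))%:E)%E.
  by rewrite -EFinM; congr EFin; field; rewrite !gt_eqF.
rewrite lee_pdivrMl// ge0_sume_distrr; last first.
  by move=> i _; apply: integral_ge0 => z _; rewrite lee_fin sqr_ge0.
apply: (@le_trans _ _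
  (\sum_(i <- s) (normc (inner_L2 D (e i j) (pole_bump r)) ^+ 2)%:E)%E).
  by rewrite sumEFin lee_fin.
by apply: lee_sum => i _; exact: one.
Qed.

(** The boxes being disjoint, the masses add up to one integral over their union inside the
    polydisc. *)
Lemma sum_mass_le (M : nat) i : (\sum_(m < M) mass m i <= sqnorm_L2 D (S (e i)))%E.
Proof.
have [eA _ _] := eonb; have [[mRe mIm _] _ _] := Ssol (eA i).
have mD := @polydisc_measurable R n.+1.
have mB m : measurable (D `&` pole_box ((1 / 2 : R) ^+ m.+1)).
  by apply: measurableI => //; exact: measurable_pole_box.
pose U := \big[setU/set0]_(m <- iota 0 M) (D `&` pole_box ((1 / 2 : R) ^+ m.+1)).
have UD : U `<=` D by rewrite /U -bigcup_seq => z [m _ []].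
have mU : measurable U by apply: bigsetU_measurable.
have mf : measurable_fun D (fun z => (normc (S (e i) z) ^+ 2)%:E).
  by apply/measurable_EFinP; exact: measurable_normc_sqr.
rewrite -(big_mkord xpredT (fun m => mass m i)) /index_iota subn0.
rewrite /mass /sqnorm_L2 -ge0_integral_bigsetU//.
- by apply: ge0_subset_integral => // z _; rewrite lee_fin sqr_ge0.
- exact: iota_uniq.
- apply/trivIsetP => a b _ _ ab.
  have /trivIsetP /(_ a b Logic.I Logic.I ab) h := @trivIset_pole_box R n.
  by rewrite setIACA setIid h setI0.
- by apply: measurable_funS mf.
- by move=> z _; rewrite lee_fin sqr_ge0.
Qed.

(** Exchanging the sum over M boxes with the sum over the basis bounds the total below by M [delta],
    for every M. *)
Lemma canonical_operator_esum (j : 'I_n.+1) : j != ord0 ->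
  (\esum_(i in [set: I]) sqnorm_L2 D (S (e i)) = +oo)%E.
Proof.
move=> j0; have [delta d0 hdelta] := mass_pole_box j0.
set T := (\esum_(i in _) _)%E.
have lower (M : nat) : ((M%:R * delta)%:E <= T)%E.
  apply: (@le_trans _ _ (\sum_(m < M) \esum_(i in [set: I]) mass m i)%E).
    rewrite (_ : (M%:R * delta)%:E = \sum_(m < M) delta%:E)%E; last first.
      by rewrite sumEFin sumr_const card_ord mulr_natl.
    apply: lee_sum => m _; have [s us hs] := hdelta m.
    (* Distinctness of the indices makes the sum over the list a sum over a finite set. *)
    apply: esum_ge; exists [set` s]; last by rewrite -fsbig_seq.
    by split=> //; exact: finite_seq.
  rewrite -esum_sum; last by move=> i m _ _; exact: mass_ge0.
  by apply: le_esum => i _; exact: sum_mass_le.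
apply/eqP; rewrite -leye_eq leNgt; apply/negP => Too.
have T0 : (0 <= T)%E.
  by apply: esum_ge0 => i _; apply: integral_ge0 => z _; rewrite lee_fin sqr_ge0.
have Tfin : T \is a fin_num by rewrite ge0_fin_numE.
(* An M with M [delta] > [T], which exists if [T] is finite. *)
have := lower (Num.bound (fine T / delta)).
rewrite -[X in (_ <= X)%E](fineK Tfin) lee_fin leNgt => /negP; apply.
by rewrite -ltr_pdivrMr// archi_boundP// divr_ge0 ?fine_ge0// ltW.
Qed.

End CanonicalOperator.

Theorem mainTheorem3 (R : realType) (n : nat) (n_ge2 : (2 <= n)%N)
    (S1 : @form01 R n -> Cn R n -> R[i]^o) :
  is_canonical_solution_operator (polydisc R n) S1 ->
  ~ hilbert_schmidt (polydisc R n) S1.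
Proof.
case: n n_ge2 S1 => [//|[//|n]] _ S1 Ssol [I [e [eonb]]].
(* With at least two coordinates the last one differs from [ord0]. *)
by rewrite (canonical_operator_esum Ssol eonb (j := ord_max)).
Qed.
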